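(* Let $(\mathfrak{M},\mathfrak{g})$ and $(M,g)$ be compact smooth Riemannian manifolds without boundary, of dimensions $m$ and $n$ respectively, and let $\pi:\mathfrak{M}\to M$ be a harmonic morphism with dilation $\lambda$. Assume there exists $\mu:M\to(0,\infty)$ such that $\mu\circ\pi=\lambda^2$. Let $p>2$ and $\varepsilon>0$. Then a positive $\mathcal{C}^2$-function $u:M\to\mathbb{R}$ solves $$-\varepsilon^2\Delta_g u+\frac1{\mu(x)}u=\frac1{\mu(x)}u^{p-1}\qquad\text{on }M$$ if and only if $v:=u\circ\pi:\mathfrak{M}\to\mathbb{R}$ solves $$-\varepsilon^2\Delta_{\mathfrak{g}}v+v=v^{p-1}\qquad\text{on }\mathfrak{M}.$$
   Context: Harmonic morphism: a smooth submersion $\pi:\mathfrak{M}\to M$ is horizontally conformal with dilation $\lambda$ if $g(d\pi X,d\pi Y)=\lambda^2\,\mathfrak{g}(X,Y)$ for all tangent vectors $X,Y$ orthogonal to the fibers of $\pi$. It is a harmonic morphism if moreover $$(n-2)\,\mathcal{H}(\nabla_{\mathfrak{g}}\ln\lambda)+(m-n)\,\kappa^{\mathcal{V}}=0,$$ where $\kappa^{\mathcal{V}}$ is the mean curvature vector of the fibers (the trace of their second fundamental form divided by $m-n$) and $\mathcal{H}$ is the orthogonal projection of the tangent space of $\mathfrak{M}$ onto the space orthogonal to the fibers. $\Delta_g$ and $\Delta_{\mathfrak{g}}$ are the Laplace-Beltrami operators.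
   Formalization: It is assumed that every connected component of M meets the image of π (automatic if M is connected and 𝔐 nonempty); otherwise ''if'' fails, e.g. π the inclusion of one circle into two disjoint circles, with u=1 on the image and u=2 on the other circle. *)

(* Defs.v *)
From mathcomp Require Import all_boot all_order all_algebra.
From mathcomp Require Import all_classical all_reals all_analysis.
Import Order.TTheory GRing.Theory Num.Theory.
Import numFieldNormedType.Exports.

Set Implicit Arguments.
Unset Strict Implicit.
Unset Printing Implicit Defensive.

Local Open Scope classical_set_scope.
Local Open Scope ring_scope.

(* Points and tangent vectors of R^n are row vectors, and the differential of
   F at x acts on the right: v |-> v *m 'J F x. *)

Section Euclidean.
Context {R : realType}.

Definition basis_vec {n} (i : 'I_n) : 'rV[R]_n := delta_mx 0 i.

Definition partial {n} (i : 'I_n) (f : 'rV[R]_n -> R) (x : 'rV[R]_n) : R :=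
  'D_(basis_vec i) f x.

(* All partial derivatives of order at most k exist and are continuous on the
   (open) set U. *)
Fixpoint Ck_on {n} (k : nat) (U : set 'rV[R]_n) (f : 'rV[R]_n -> R) : Prop :=
  (forall x, U x -> {for x, continuous f}) /\
  match k with
  | 0 => True
  | k'.+1 => forall i : 'I_n,
      (forall x, U x -> derivable f x (basis_vec i)) /\ Ck_on k' U (partial i f)
  end.

Definition smooth_on {n} (U : set 'rV[R]_n) (f : 'rV[R]_n -> R) : Prop :=
  forall k, Ck_on k U f.

Definition smooth_vec_on {m n} (U : set 'rV[R]_m) (F : 'rV[R]_m -> 'rV[R]_n) :
    Prop :=
  forall j, smooth_on U (fun x => F x 0 j).

End Euclidean.

Section Manifolds.
Context {R : realType}.

(* chart_inv is relevant only on the open set chart_map @` chart_dom. *)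
Record chart (n : nat) (M : topologicalType) := Chart {
  chart_dom : set M;
  chart_map :> M -> 'rV[R]_n;
  chart_inv : 'rV[R]_n -> M;
  chart_dom_open : open chart_dom;
  chart_cod_open : open (chart_map @` chart_dom);
  chart_mapK : forall x, chart_dom x -> chart_inv (chart_map x) = x;
  chart_map_continuous : forall x, chart_dom x -> {for x, continuous chart_map};
  chart_inv_continuous :
    forall y, (chart_map @` chart_dom) y -> {for y, continuous chart_inv} }.

Definition chart_cod n (M : topologicalType) (a : chart n M) : set 'rV[R]_n :=
  a @` chart_dom a.

Record smooth_manifold (n : nat) := SmoothManifold {
  manifold_space :> topologicalType;
  manifold_hausdorff : hausdorff_space manifold_space;
  manifold_second_countable : @second_countable manifold_space;
  atlas : set (chart n manifold_space);
  atlas_cover : forall x, exists2 a, atlas a & chart_dom a x;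
  atlas_compatible : forall a b, atlas a -> atlas b ->
    smooth_vec_on (a @` (chart_dom a `&` chart_dom b)) (b \o chart_inv a) }.

Definition chart_at n (M : smooth_manifold n) (x : M) : chart n M :=
  s2val (cid2 (atlas_cover x)).

(* metric a y is the Gram matrix (g_ij) of the coordinate frame of the chart a
   at the point with coordinates y; metric_change is the transformation law of
   a covariant 2-tensor. *)
Record riemannian_manifold (n : nat) := RiemannianManifold {
  riemannian_space :> smooth_manifold n;
  metric : chart n riemannian_space -> 'rV[R]_n -> 'M[R]_n;
  metric_smooth : forall a, atlas a ->
    forall i j, smooth_on (chart_cod a) (fun y => metric a y i j);
  metric_sym : forall a, atlas a ->
    forall y, chart_cod a y -> (metric a y)^T = metric a y;
  metric_pos : forall a, atlas a -> forall y, chart_cod a y ->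
    forall v : 'rV[R]_n, v != 0 -> 0 < (v *m metric a y *m v^T) 0 0;
  metric_change : forall a b, atlas a -> atlas b ->
    forall x, chart_dom a x -> chart_dom b x ->
    let J := 'J (b \o chart_inv a) (a x) in
    metric a (a x) = J *m metric b (b x) *m J^T }.

Definition Ck_function n (M : smooth_manifold n) (k : nat) (f : M -> R) : Prop :=
  forall a, @atlas n M a -> Ck_on k (chart_cod a) (f \o chart_inv a).

Definition in_charts m n (N : smooth_manifold m) (M : smooth_manifold n)
    (pi : N -> M) (a : chart m N) (b : chart n M) : 'rV[R]_m -> 'rV[R]_n :=
  b \o pi \o chart_inv a.

Definition smooth_map m n (N : smooth_manifold m) (M : smooth_manifold n)
    (pi : N -> M) : Prop :=
  continuous pi /\
  forall a b, @atlas m N a -> @atlas n M b ->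
    smooth_vec_on (a @` (chart_dom a `&` (pi @^-1` chart_dom b)))
                  (in_charts pi a b).

End Manifolds.

Section LocalRiemannianGeometry.
Context {R : realType} {n : nat}.
Variable G : 'rV[R]_n -> 'M[R]_n.
Implicit Types (X Y : 'rV[R]_n -> 'rV[R]_n) (f : 'rV[R]_n -> R) (y : 'rV[R]_n).

(* Gamma^k_ij of the Levi-Civita connection *)
Definition christoffel (k i j : 'I_n) y : R :=
  2^-1 * \sum_l invmx (G y) k l *
    (partial i (fun z => G z j l) y + partial j (fun z => G z i l) y
     - partial l (fun z => G z i j) y).

Definition nabla X Y y : 'rV[R]_n :=
  \row_k (\sum_i X y 0 i * partial i (fun z => Y z 0 k) y
          + \sum_i \sum_j X y 0 i * Y y 0 j * christoffel k i j y).

Definition gradient f y : 'rV[R]_n :=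
  \row_k \sum_l invmx (G y) k l * partial l f y.

(* trace of the endomorphism Z |-> nabla_Z X *)
Definition divergence X y : R :=
  \sum_i nabla (fun=> basis_vec i) X y 0 i.

Definition laplacian f y : R := divergence (gradient f) y.

End LocalRiemannianGeometry.

Definition laplace_beltrami {R : realType} {n} {M : riemannian_manifold n}
    (f : M -> R) (x : M) : R :=
  let a := chart_at x in laplacian (metric a) (f \o chart_inv a) (a x).

(* The fibers of P : R^m -> R^n, for the metric G on R^m. Spaces of tangent
   vectors are row spaces of square matrices. *)
Section Fibers.
Context {R : realType} {m n : nat}.
Variables (G : 'rV[R]_m -> 'M[R]_m) (P : 'rV[R]_m -> 'rV[R]_n).
Implicit Types (X Y : 'rV[R]_m -> 'rV[R]_m) (y : 'rV[R]_m).

Definition vertical y : 'M[R]_m := kermx ('J P y).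

Definition horizontal y : 'M[R]_m := kermx (G y *m (vertical y)^T).

Definition hproj y : 'M[R]_m := proj_mx (horizontal y) (vertical y).
Definition vproj y : 'M[R]_m := 1%:M - hproj y.

(* (X, Y) |-> H (nabla_X Y) on vertical fields, extended by zero to horizontal
   ones; it is tensorial, so its value at y depends only on X y and Y y. *)
Definition second_fundamental_form X Y y : 'rV[R]_m :=
  nabla G (fun z => X z *m vproj z) (fun z => Y z *m vproj z) y *m hproj y.

(* As the extended form vanishes on horizontal vectors, its trace over the
   whole tangent space, sum_ij G^ij B(d_i, d_j), is its trace over the tangent
   space of the fiber. *)
Definition mean_curvature y : 'rV[R]_m :=
  (m%:R - n%:R)^-1 *: \sum_i \sum_j invmx (G y) i j *:
    second_fundamental_form (fun=> basis_vec i) (fun=> basis_vec j) y.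

End Fibers.

Section HarmonicMorphisms.
Context {R : realType} {m n : nat}.
Context {N : @riemannian_manifold R m} {M : @riemannian_manifold R n}.
Implicit Types (pi : N -> M) (lambda : N -> R).

Definition for_charts pi
    (Q : chart m N -> chart n M -> N -> Prop) : Prop :=
  forall a b, @atlas R m N a -> @atlas R n M b ->
  forall x, chart_dom a x -> chart_dom b (pi x) -> Q a b x.

Definition submersion pi : Prop :=
  smooth_map pi /\
  for_charts pi (fun a b x => \rank ('J (in_charts pi a b) (a x)) = n).

Definition horizontally_conformal pi lambda : Prop :=
  (forall x, 0 < lambda x) /\
  for_charts pi (fun a b x =>
    let D := 'J (in_charts pi a b) (a x) in
    let H := horizontal (metric a) (in_charts pi a b) (a x) in
    forall X Y : 'rV[R]_m, (X <= H)%MS -> (Y <= H)%MS ->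
      (X *m D) *m metric b (b (pi x)) *m (Y *m D)^T
      = lambda x ^+ 2 *: (X *m metric a (a x) *m Y^T)).

Definition harmonic_morphism pi lambda : Prop :=
  [/\ submersion pi, horizontally_conformal pi lambda &
  for_charts pi (fun a b x =>
    let G := metric a in
    let P := in_charts pi a b in
    let y := a x in
    (n%:R - 2) *: (gradient G (fun z => ln (lambda (chart_inv a z))) y
                   *m hproj G P y)
    + (m%:R - n%:R) *: mean_curvature G P y = 0)].

End HarmonicMorphisms.

(* Main.v *)
From HB Require Import structures.
Require Import Defs.
From mathcomp Require Import all_boot all_order all_algebra.
From mathcomp Require Import all_classical all_reals all_analysis.
From mathcomp Require Import ring lra.
Import Order.TTheory GRing.Theory Num.Theory.
Import numFieldNormedType.Exports.
Local Open Scope classical_set_scope.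
Local Open Scope ring_scope.

Set Implicit Arguments.
Unset Strict Implicit.
Unset Printing Implicit Defensive.

(** The identity that drives the proof is
      Delta (u o pi) = lambda^2 (Delta u) o pi
    for every C^2 function u on M ([laplace_beltrami_comp]).  Since
    mu o pi = lambda^2, it makes the equation for v at x equal to lambda^2
    times the equation for u at pi x.  The equation for u therefore implies
    the one for v, and the converse holds because pi is onto
    ([submersion_surjective]).

    The identity is local.  In charts around x and pi x, let P be the
    expression of pi, D its Jacobian (tangent vectors are rows, so D is
    m x n), G and g the two Gram matrices, K and k their inverses.  The rows
    of A = D^T K are the gradients of the components of P, and S = A D is the
    Gram matrix of these gradients.  The Laplacian is the trace of the Hessian
    ([laplacian_hessian]), so the chain rule gives
      Delta (h o P) = sum_ab S_ab d_a d_b h + sum_b (Delta P_b) d_b h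
    ([laplacian_comp_expansion]).  Horizontal conformality means that
    S = lambda^2 k ([conformal_gram]), which settles the second order terms.
    For the first order terms it remains to see that
    Delta P_b = lambda^2 (Delta w_b) o P, where w_b is the b-th coordinate
    function downstairs ([laplacian_component]).

    To this end the trace of Hess P_b is split into a vertical and a
    horizontal part.  P_b is constant on the fibers, so differentiating
    dP_b(V) = 0 shows that the vertical part is - (m - n) dP_b(kappa), kappa
    being the mean curvature ([trace_second_fundamental_form]).  The
    horizontal part is determined by the numbers
    Hess P_b (grad P_a, grad P_c), which polarization expresses through first
    derivatives of S ([hessian_gram]), as the Koszul formula does for the
    Levi-Civita connection.  Inserting S = lambda^2 k o P, the trace becomes
    lambda^2 (Delta w_b) o P - (n - 2) <grad ln lambda, grad P_b>
    ([conformal_contraction]).  The equation of a harmonic morphism, applied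
    to dP_b, says exactly that the two unwanted terms cancel.

    Surjectivity: the range of pi is compact, hence closed.  It is also open:
    if c is close to a point of the range in a chart, then the point of the
    range closest to c stays inside the chart, and a critical point of the
    distance to c along a submersion is at distance zero
    ([submersion_local_min]).  So the range contains every connected component
    that it meets. *)

(** * Differentiability of functions with continuous partial derivatives *)

Section calc.
Context {R : realType}.

Lemma is_derive_line n (f : 'rV[R]_n -> R) (x v : 'rV[R]_n) (t : R) :
  derivable f (x + t *: v) v ->
  is_derive t 1 (fun s => f (x + s *: v)) ('D_v f (x + t *: v)).
Proof.
move=> dfx.
have E : (fun h : R => h^-1 *: (((fun s => f (x + s *: v)) \o shift t) (h *: 1) -
   f (x + t *: v))) =
  (fun h : R => h^-1 *: ((f \o shift (x + t *: v)) (h *: v) - f (x + t *: v))).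
  apply/funext => h /=; congr (_ *: (f _ - _)).
  by rewrite [h%:A]mulr1 scalerDl addrCA.
split; first by rewrite /derivable E.
by rewrite /derive E.
Qed.

(** The increment [s] may have either sign, hence the absolute values. *)
Lemma partial_mvt n (f : 'rV[R]_n -> R) (i : 'I_n) (x : 'rV[R]_n) (s : R) :
  (forall t : R, `|t| <= `|s| -> derivable f (x + t *: basis_vec i) (basis_vec i)) ->
  exists2 c : R, `|c| <= `|s| &
    f (x + s *: basis_vec i) - f x = s * partial i f (x + c *: basis_vec i).
Proof.
move=> df; set v := basis_vec i in df *.
pose phi t := f (x + t *: v); pose dphi t := partial i f (x + t *: v).
have dphiP (t : R) : `|t| <= `|s| -> is_derive t 1 phi (dphi t).
  by move=> ts; exact/is_derive_line/df.
have cphi (a b : R) : (forall t, t \in `[a, b] -> `|t| <= `|s|) ->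
    {within `[a, b], continuous phi}.
  move=> abs; apply: derivable_within_continuous => t tab.
  by have [] := dphiP t (abs t tab).
have [s0|/ltW s0] := leP 0 s.
- have i0s (t : R) : t \in `[0, s] -> `|t| <= `|s|.
    by rewrite in_itv/= => /andP[t0 ts]; rewrite !ger0_norm.
  have [c c0s E] := @MVT_segment R phi dphi 0 s s0
    (fun t t0s => dphiP t (i0s t (subset_itv_oo_cc t0s))) (cphi _ _ i0s).
  exists c; first exact: i0s.
  by move: E; rewrite /phi scale0r addr0 subr0 mulrC.
- have i0s (t : R) : t \in `[s, 0] -> `|t| <= `|s|.
    by rewrite in_itv/= => /andP[t0 ts]; rewrite !ler0_norm// lerN2.
  have [c c0s E] := @MVT_segment R phi dphi s 0 s0
    (fun t t0s => dphiP t (i0s t (subset_itv_oo_cc t0s))) (cphi _ _ i0s).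
  exists c; first exact: i0s.
  move: E; rewrite /phi scale0r addr0 sub0r => /(congr1 -%R).
  by rewrite opprB mulrN opprK mulrC.
Qed.

Lemma coord_le_norm n (x : 'rV[R]_n) i : `|x 0 i| <= `|x|.
Proof.
rewrite [leRHS]/Num.Def.normr/= mx_normrE.
exact: (le_bigmax _ (fun ij : 'I_1 * 'I_n => `|x ij.1 ij.2|) (0, i)).
Qed.

Lemma norm_le_coord n (x : 'rV[R]_n) (e : R) : 0 <= e ->
  (forall i, `|x 0 i| <= e) -> `|x| <= e.
Proof.
move=> e0 H; rewrite [leLHS]/Num.Def.normr/= mx_normrE.
by apply: bigmax_le => // -[k i] _; rewrite (ord1 k).
Qed.

Lemma differentiable_fsum (V : normedModType R) (I : Type) (s : seq I)
    (F : I -> V -> R) (x : V) :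
  (forall j, differentiable (F j) x) ->
  differentiable (fun z => \sum_(j <- s) F j z) x.
Proof.
move=> dF; elim: s => [|j s IH].
  rewrite (_ : (fun _ => _) = cst 0); first exact: differentiable_cst.
  by apply/funext => z; rewrite big_nil.
rewrite (_ : (fun _ => _) = F j + (fun z => \sum_(j <- s) F j z)).
  exact: differentiableD.
by apply/funext => z; rewrite big_cons.
Qed.

Lemma differentiable_approx (V W : normedModType R) (f : V -> W)
    (df : {linear V -> W}) x : continuous df ->
  (forall e, 0 < e -> \forall h \near (0 : V),
     `|f (h + x) - (f x + df h)| <= e * `|h|) ->
  differentiable f x.
Proof.
move=> dfC fdf.
suff H : f \o shift x = cst (f x) + df +o_ 0 id.
  by apply/diff_locallyP; rewrite (diff_unique dfC H).
by apply/eqaddoP => e /fdf.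
Qed.

(** The increment of [f] is a sum of increments along coordinate directions;
    each of them is, by the mean value theorem, a partial derivative at a nearby
    point, which continuity compares with the one at [x]. *)
Lemma C1_differentiable n (U : set 'rV[R]_n) (f : 'rV[R]_n -> R) x :
  open U -> U x -> Ck_on 1 U f -> differentiable f x.
Proof.
move=> oU Ux [_ fC1].
pose c i := partial i f x.
pose L h : R := \sum_i (h : 'rV[R]_n) 0 i * c i.
have L_lin : linear_for *:%R L.
  move=> a h k; rewrite /L scaler_sumr -big_split/=; apply: eq_bigr => i _.
  by rewrite !mxE mulrDl -mulrA.
pose LM := GRing.isLinear.Build _ _ _ _ L L_lin.
pose LL : {linear 'rV[R]_n -> R} := HB.pack L LM.
have LC : continuous LL.
  move=> h; apply/differentiable_continuous/differentiable_fsum => i.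
  by apply: differentiableM => //; exact: differentiable_coord.
apply: (differentiable_approx LC) => _/posnumP[e].
pose d := e%:num / n.+1%:R.
have d0 : 0 < d by rewrite divr_gt0.
have : \forall z \near x, U z /\ forall i, `|partial i f z - c i| <= d.
  near=> z; split; first by near: z; exact: open_nbhs_nbhs.
  near: z; apply: filter_forall => i; near=> z.
  rewrite distrC; near: z; apply: cvgr_dist_le => //.
  by have [_ [+ _]] := fC1 i; exact.
move=> /nbhs_ballP[r /= r0 rP].
near=> h.
have hr : `|h| < r by near: h; exact: (@nbhs0_lt R 'rV[R]_n).
(* [w k] has the first [k] coordinates of [h + x] and the others of [x] *)
pose w k := x + \row_j (if (j < k)%N then h 0 j else 0).
have wS (k : 'I_n) : w k.+1 = w k + h 0 k *: basis_vec k.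
  apply/rowP => j; rewrite /w !mxE eqxx/= ltnS -addrA; congr (_ + _).
  rewrite leq_eqVlt (inj_eq val_inj); case: eqVneq => [->|jk].
    by rewrite ltnn/= mulr1 add0r.
  by rewrite mulr0 addr0.
have w0 : w 0%N = x.
  by apply/rowP => j; rewrite !mxE/= addr0.
have wn : w n = h + x.
  by apply/rowP => j; rewrite !mxE/= ltn_ord addrC.
have wb k (t : R) : (k < n)%N -> `|t| <= `|h| ->
    forall i : 'I_n, (i : nat) = k -> ball x r (w k + t *: basis_vec i).
  move=> kn th i ik; rewrite -ball_normE/= (le_lt_trans _ hr)//.
  apply: norm_le_coord => // j; rewrite !mxE eqxx/= opprD addrA opprD addrA.
  rewrite subrr sub0r -opprD normrN -ik.
  have [jk|jk|/val_inj ->] := ltngtP j i.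
  - rewrite (_ : (j == i) = false) ?mulr0 ?addr0 ?coord_le_norm//.
    by rewrite -(inj_eq val_inj) ltn_eqF.
  - rewrite (_ : (j == i) = false) ?mulr0 ?addr0 ?normr0//.
    by rewrite -(inj_eq val_inj) gtn_eqF.
  - by rewrite eqxx mulr1 add0r.
rewrite /= /L.
have -> : f (h + x) - (f x + \sum_i h 0 i * c i) =
    \sum_(i < n) (f (w i.+1) - f (w i) - h 0 i * c i).
  rewrite sumrB opprD addrA; congr (_ - _).
  by rewrite -(big_mkord xpredT (fun k => f (w k.+1) - f (w k)))
    telescope_sumr// wn w0.
apply: (le_trans (ler_norm_sum _ _ _)).
apply: (@le_trans _ _ (\sum_(i < n) (d * `|h|))).
  apply: ler_sum => i _; rewrite wS.
  have [t ti ->] : exists2 t : R, `|t| <= `|h 0 i| &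
      f (w i + h 0 i *: basis_vec i) - f (w i) =
      h 0 i * partial i f (w i + t *: basis_vec i).
    apply: partial_mvt => t ti.
    have /rP[Uw _] : ball x r (w i + t *: basis_vec i).
      by apply: wb => //; rewrite (le_trans ti)// coord_le_norm.
    by have [+ _] := fC1 i; exact.
  rewrite -mulrBr normrM mulrC ler_pM//; last exact: coord_le_norm.
  have /rP[_] : ball x r (w i + t *: basis_vec i).
    by apply: wb => //; rewrite (le_trans ti)// coord_le_norm.
  exact.
rewrite sumr_const card_ord -mulr_natl mulrA ler_wpM2r// /d mulrCA.
by rewrite ger_pMr// ler_pdivrMr// mul1r ler_nat.
Unshelve. all: by end_near. Qed.

End calc.

(** * Symmetry of second partial derivatives *)

Section schwarz.
Context {R : realType}.

Lemma is_derive_translate (V W : normedModType R) (f : V -> W) (a x v : V) :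
  derivable f (x + a) v ->
  is_derive x v (fun z => f (z + a)) ('D_v f (x + a)).
Proof.
move=> dfx.
have E : (fun h : R => h^-1 *: (((fun z => f (z + a)) \o shift x) (h *: v) - f (x + a))) =
  (fun h : R => h^-1 *: ((f \o shift (x + a)) (h *: v) - f (x + a))).
  by apply/funext => h /=; rewrite addrA.
split; first by rewrite /derivable E.
by rewrite /derive E.
Qed.

Lemma norm_basis_vec n (i : 'I_n) : `|basis_vec i : 'rV[R]_n| <= 1.
Proof.
apply: norm_le_coord => // j; rewrite mxE eqxx/=.
by case: (j == i); rewrite ?normr1 ?normr0.
Qed.

Lemma norm_scale_basis_vec n (i : 'I_n) (t s : R) : `|t| <= s ->
  `|t *: basis_vec i : 'rV[R]_n| <= s.
Proof.
move=> ts; rewrite normrZ (le_trans _ ts)// -[leRHS]mulr1.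
by rewrite ler_wpM2l// norm_basis_vec.
Qed.

(** Two applications of the mean value theorem.  The left-hand side is
    symmetric in [i] and [j], which is what gives [partialC]. *)
Lemma second_difference n (U : set 'rV[R]_n) (f : 'rV[R]_n -> R) x (i j : 'I_n)
    (s : R) : 0 <= s -> Ck_on 2 U f ->
  (forall z, `|z - x| <= s + s -> U z) ->
  exists2 z, `|z - x| <= s + s &
    f (x + s *: basis_vec i + s *: basis_vec j) - f (x + s *: basis_vec i)
    - (f (x + s *: basis_vec j) - f x)
    = s * (s * partial j (partial i f) z).
Proof.
move=> s0 [_ fC2] xU.
have dist (t c : R) : `|t| <= s -> `|c| <= s ->
    `|x + t *: basis_vec i + c *: basis_vec j - x| <= s + s.
  move=> ts cs; rewrite addrAC [x + _]addrC addrK.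
  by rewrite (le_trans (ler_normD _ _))// lerD// norm_scale_basis_vec.
have dist0 (t : R) : `|t| <= s -> `|x + t *: basis_vec i - x| <= s + s.
  by move=> ts; have := dist t 0 ts; rewrite normr0 scale0r addr0; apply.
have ss : `|s| = s by rewrite ger0_norm.
pose psi := (fun w => f (w + s *: basis_vec j)) - f.
have dpsi (t : R) : `|t| <= `|s| ->
    is_derive (x + t *: basis_vec i) (basis_vec i) psi
      (partial i f (x + t *: basis_vec i + s *: basis_vec j)
       - partial i f (x + t *: basis_vec i)).
  rewrite ss => ts; apply: is_deriveB.
    apply: is_derive_translate; have [+ _] := fC2 i; apply.
    by apply/xU/dist => //; rewrite ss.
  apply: derivableP; have [+ _] := fC2 i; apply.
  exact/xU/dist0.
have [c cs E] : exists2 c : R, `|c| <= `|s| & psi (x + s *: basis_vec i) - psi x =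
    s * partial i psi (x + c *: basis_vec i).
  by apply: partial_mvt => t /dpsi[].
rewrite ss in cs.
have [d ds F] : exists2 d : R, `|d| <= `|s| &
    partial i f (x + c *: basis_vec i + s *: basis_vec j)
    - partial i f (x + c *: basis_vec i) =
    s * partial j (partial i f) (x + c *: basis_vec i + d *: basis_vec j).
  apply: partial_mvt => t; rewrite ss => ts.
  have [_ [_ +]] := fC2 i => /(_ j)[+ _]; apply.
  exact/xU/dist.
rewrite ss in ds.
exists (x + c *: basis_vec i + d *: basis_vec j); first exact: dist.
rewrite -F.
have <- : partial i psi (x + c *: basis_vec i) =
    partial i f (x + c *: basis_vec i + s *: basis_vec j)
    - partial i f (x + c *: basis_vec i).
  by have := dpsi c; rewrite ss => /(_ cs) [].
by rewrite -E.
Qed.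

(** The two second differences coincide, so the mixed derivatives agree at two
    points close to [x]; let these points tend to [x]. *)
Lemma partialC n (U : set 'rV[R]_n) (f : 'rV[R]_n -> R) x (i j : 'I_n) :
  open U -> U x -> Ck_on 2 U f ->
  partial i (partial j f) x = partial j (partial i f) x.
Proof.
move=> oU Ux fC2.
have cont k l : {for x, continuous (partial k (partial l f))}.
  by have [_ /(_ l)[_ [_ /(_ k)[_ [+ _]]]]] := fC2; exact.
apply/eqP; rewrite -subr_eq0 -normr_le0; apply/ler_addgt0Pl => e e0; rewrite addr0.
have : \forall z \near x, [/\ U z,
    `|partial i (partial j f) x - partial i (partial j f) z| <= e / 2 &
    `|partial j (partial i f) x - partial j (partial i f) z| <= e / 2].
  have e2 : 0 < e / 2 by rewrite divr_gt0.
  have nU : \forall z \near x, U z by exact: open_nbhs_nbhs.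
  have nij := cvgr_dist_le (FF := nbhs_filter x) _ _ (cont i j) _ e2.
  have nji := cvgr_dist_le (FF := nbhs_filter x) _ _ (cont j i) _ e2.
  apply: filterS3 nU nij nji => z Uz zij zji.
  by split; [exact: Uz|exact: zij|exact: zji].
move=> /nbhs_ballP[r /= r0 rP].
pose s := r / 4.
have s0 : 0 < s by rewrite divr_gt0.
have ssr : s + s < r.
  rewrite /s -mulr2n -[_ *+ 2]mulr_natr -mulrA gtr_pMr// mulrC.
  by rewrite ltr_pdivrMr// mul1r ltr_nat.
have near_x z : `|z - x| <= s + s -> ball x r z.
  by move=> zx; rewrite -ball_normE/= distrC (le_lt_trans zx).
have sU z : `|z - x| <= s + s -> U z by move=> /near_x/rP[].
have [z /near_x/rP[_ _ zP] Ez] := second_difference i j (ltW s0) fC2 sU.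
have [w /near_x/rP[_ wP _] Ew] := second_difference j i (ltW s0) fC2 sU.
(* [p] and [q] are the mixed derivatives at [w] and [z], [X] and [Y] the two
   second differences *)
have key (P Q p q X Y : R) : X = s * (s * q) -> Y = s * (s * p) -> X = Y ->
    `|P - p| <= e / 2 -> `|Q - q| <= e / 2 -> `|P - Q| <= e.
  move=> -> -> /(mulfI (lt0r_neq0 s0))/(mulfI (lt0r_neq0 s0)) -> Pp Qp.
  rewrite (splitr e) -(subrK p P) -addrA (le_trans (ler_normD _ _))// lerD//.
  by rewrite distrC.
refine (key _ _ _ _ _ _ Ez Ew _ wP zP).
rewrite [x + s *: basis_vec j + _]addrAC.
by ring.
Qed.

End schwarz.

(** * Partial derivatives of products, inverses and composites *)

Section partial_calculus.
Context {R : realType} {n : nat}.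
Implicit Types (f g : 'rV[R]_n -> R) (x : 'rV[R]_n) (i : 'I_n).

Lemma near_eq_differentiable (V W : normedModType R) (f g : V -> W) (x : V) :
  (\forall z \near x, f z = g z) -> differentiable f x -> differentiable g x.
Proof.
move=> fg df.
apply: (@differentiable_approx R V W g ('d f x) x (diff_continuous df)) => e e0.
have fgx : f x = g x := nbhs_singleton fg.
have fgh : \forall h \near (0 : V), f (h + x) = g (h + x).
  by have := fg; rewrite (near_shift 0 x)/=; apply: filterS => h; rewrite subr0.
have /eqaddoP/(_ e e0) dfe := diff_locally df.
apply: filterS2 fgh dfe => h fghx H.
by rewrite -fghx -fgx.
Qed.

Lemma partial_near i f g x : (\forall z \near x, f z = g z) ->
  partial i f x = partial i g x.
Proof. exact: near_eq_derive. Qed.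

Lemma partial_cst i (c : R) x : partial i (fun=> c) x = 0.
Proof. exact: derive_cst. Qed.

Lemma partialM i f g x : differentiable f x -> differentiable g x ->
  partial i (fun z => f z * g z) x = partial i f x * g x + f x * partial i g x.
Proof.
move=> df dg; rewrite addrC [X in _ + X]mulrC.
have {}df : derivable f x (basis_vec i) by exact: diff_derivable.
have {}dg : derivable g x (basis_vec i) by exact: diff_derivable.
exact: (deriveM df dg).
Qed.

Lemma partial_sum k i (F : 'I_k -> 'rV[R]_n -> R) x :
  (forall j, differentiable (F j) x) ->
  partial i (fun z => \sum_j F j z) x = \sum_j partial i (F j) x.
Proof.
move=> dF; rewrite /partial -derive_sum; last by move=> j; exact: diff_derivable.
by congr ('D_ _ _ x); apply/funext => z; rewrite fct_sumE.
Qed.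

Lemma differentiable_fprod (V : normedModType R) (I : Type) (s : seq I)
    (F : I -> V -> R) (x : V) :
  (forall j, differentiable (F j) x) ->
  differentiable (fun z => \prod_(j <- s) F j z) x.
Proof.
move=> dF; elim: s => [|j s IH].
  rewrite (_ : (fun _ => _) = cst 1); first exact: differentiable_cst.
  by apply/funext => z; rewrite big_nil.
rewrite (_ : (fun _ => _) = F j * (fun z => \prod_(j <- s) F j z)).
  exact: differentiableM.
by apply/funext => z; rewrite big_cons.
Qed.

End partial_calculus.

Definition mx_differentiable {R : realType} {n p q} (F : 'rV[R]_n -> 'M[R]_(p, q)) x :=
  forall a b, differentiable (fun z => F z a b) x.

Definition partial_mx {R : realType} {n p q} (i : 'I_n)
    (F : 'rV[R]_n -> 'M[R]_(p, q)) x : 'M[R]_(p, q) :=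
  \matrix_(a, b) partial i (fun z => F z a b) x.

Section matrix_calculus.
Context {R : realType} {n : nat}.
Implicit Types (x : 'rV[R]_n) (i : 'I_n).

Lemma mx_differentiable_near p q (F H : 'rV[R]_n -> 'M[R]_(p, q)) x :
  (\forall z \near x, F z = H z) -> mx_differentiable F x -> mx_differentiable H x.
Proof.
move=> FH dF a b; apply: near_eq_differentiable (dF a b).
by apply: filterS FH => z ->.
Qed.

Lemma partial_mx_near p q i (F H : 'rV[R]_n -> 'M[R]_(p, q)) x :
  (\forall z \near x, F z = H z) -> partial_mx i F x = partial_mx i H x.
Proof.
move=> FH; apply/matrixP => a b; rewrite !mxE; apply: partial_near.
by apply: filterS FH => z ->.
Qed.

Lemma mx_differentiable_cst p q (A : 'M[R]_(p, q)) x :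
  mx_differentiable (fun=> A) x.
Proof. by move=> a b; exact: differentiable_cst. Qed.

Lemma partial_mx_cst p q i (A : 'M[R]_(p, q)) x : partial_mx i (fun=> A) x = 0.
Proof. by apply/matrixP => a b; rewrite !mxE partial_cst. Qed.

Lemma mx_differentiableM p q r (F : 'rV[R]_n -> 'M[R]_(p, q))
    (H : 'rV[R]_n -> 'M[R]_(q, r)) x :
  mx_differentiable F x -> mx_differentiable H x ->
  mx_differentiable (fun z => F z *m H z) x.
Proof.
move=> dF dH a b; under eq_fun do rewrite mxE.
by apply: differentiable_fsum => j; exact: differentiableM.
Qed.

Lemma partial_mxM p q r i (F : 'rV[R]_n -> 'M[R]_(p, q))
    (H : 'rV[R]_n -> 'M[R]_(q, r)) x :
  mx_differentiable F x -> mx_differentiable H x ->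
  partial_mx i (fun z => F z *m H z) x =
  partial_mx i F x *m H x + F x *m partial_mx i H x.
Proof.
move=> dF dH; apply/matrixP => a b; rewrite !mxE -big_split/=.
under eq_fun do rewrite mxE.
rewrite partial_sum; last by move=> j; exact: differentiableM.
by apply: eq_bigr => j _; rewrite !mxE partialM.
Qed.

Lemma mx_differentiableZ p q (s : 'rV[R]_n -> R) (F : 'rV[R]_n -> 'M[R]_(p, q)) x :
  differentiable s x -> mx_differentiable F x ->
  mx_differentiable (fun z => s z *: F z) x.
Proof.
by move=> ds dF a b; under eq_fun do rewrite mxE; exact: differentiableM.
Qed.

Lemma partial_mxZ p q i (s : 'rV[R]_n -> R) (F : 'rV[R]_n -> 'M[R]_(p, q)) x :
  differentiable s x -> mx_differentiable F x ->
  partial_mx i (fun z => s z *: F z) x =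
  partial i s x *: F x + s x *: partial_mx i F x.
Proof.
move=> ds dF; apply/matrixP => a b; rewrite !mxE; under eq_fun do rewrite mxE.
exact: partialM.
Qed.

Lemma mx_differentiable_tr p q (F : 'rV[R]_n -> 'M[R]_(p, q)) x :
  mx_differentiable F x -> mx_differentiable (fun z => (F z)^T) x.
Proof. by move=> dF a b; under eq_fun do rewrite mxE; exact: dF. Qed.

Lemma partial_mx_tr p q i (F : 'rV[R]_n -> 'M[R]_(p, q)) x :
  partial_mx i (fun z => (F z)^T) x = (partial_mx i F x)^T.
Proof.
by apply/matrixP => a b; rewrite !mxE; under eq_fun do rewrite mxE.
Qed.

Lemma mx_differentiableB p q (F H : 'rV[R]_n -> 'M[R]_(p, q)) x :
  mx_differentiable F x -> mx_differentiable H x ->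
  mx_differentiable (fun z => F z - H z) x.
Proof.
by move=> dF dH a b; under eq_fun do rewrite !mxE; exact: differentiableB.
Qed.

Lemma differentiable_det p (F : 'rV[R]_n -> 'M[R]_p) x :
  mx_differentiable F x -> differentiable (fun z => \det (F z)) x.
Proof.
move=> dF; rewrite /determinant; apply: differentiable_fsum => s.
apply: differentiableM; first exact: differentiable_cst.
by apply: differentiable_fprod => j; exact: dF.
Qed.

Lemma mx_differentiable_adj p (F : 'rV[R]_n -> 'M[R]_p) x :
  mx_differentiable F x -> mx_differentiable (fun z => \adj (F z)) x.
Proof.
move=> dF a b; under eq_fun do rewrite mxE /cofactor.
apply: differentiableM; first exact: differentiable_cst.
by apply: differentiable_det => c d; under eq_fun do rewrite !mxE; exact: dF.
Qed.

Lemma mx_differentiable_inv p (F : 'rV[R]_n -> 'M[R]_p) x :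
  mx_differentiable F x -> (\forall z \near x, F z \in unitmx) ->
  mx_differentiable (fun z => invmx (F z)) x.
Proof.
move=> dF uF.
apply: (@mx_differentiable_near _ _ (fun z => (\det (F z))^-1 *: \adj (F z))).
  by apply: filterS uF => z; rewrite /invmx => ->.
apply: mx_differentiableZ; last exact: mx_differentiable_adj.
apply: differentiableV; first exact: differentiable_det.
by have := nbhs_singleton uF; rewrite unitmxE unitfE.
Qed.

(** Differentiate [F *m invmx F = 1]. *)
Lemma partial_mx_inv p i (F : 'rV[R]_n -> 'M[R]_p) x :
  mx_differentiable F x -> (\forall z \near x, F z \in unitmx) ->
  partial_mx i (fun z => invmx (F z)) x =
  - (invmx (F x) *m partial_mx i F x *m invmx (F x)).
Proof.
move=> dF uF; have dK := mx_differentiable_inv dF uF.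
have uFx := nbhs_singleton uF.
have : partial_mx i (fun z => F z *m invmx (F z)) x = 0.
  rewrite -(partial_mx_cst i 1%:M x); apply: partial_mx_near.
  by apply: filterS uF => z uz; rewrite mulmxV.
rewrite partial_mxM// => /eqP; rewrite addr_eq0 => /eqP E.
by rewrite -mulmxA E mulmxN opprK mulmxA mulVmx// mul1mx.
Qed.

End matrix_calculus.

Section chain_rule.
Context {R : realType} {m n : nat}.
Implicit Types (P : 'rV[R]_m -> 'rV[R]_n) (h : 'rV[R]_n -> R).

Lemma differentiable_rV P y : (forall a, differentiable (fun z => P z 0 a) y) ->
  differentiable P y.
Proof.
move=> dP.
rewrite (_ : P = \sum_a (fun z => P z 0 a *: basis_vec a)).
  by apply: differentiable_sum => a; exact: differentiableZl.
by apply/funext => z; rewrite fct_sumE [LHS]row_sum_delta.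
Qed.

(** Row vectors on the left: the row index of the Jacobian is the direction of
    differentiation. *)
Lemma jacobianE P y i a : differentiable P y ->
  'J P y i a = partial i (fun z => P z 0 a) y.
Proof.
move=> dP; rewrite /jacobian /lin1_mx mxE.
by rewrite -[in LHS](deriveE _ dP) derive_mx ?mxE//; exact: diff_derivable.
Qed.

Lemma partial_comp P h y i : differentiable P y -> differentiable h (P y) ->
  partial i (h \o P) y = \sum_a 'J P y i a * partial a h (P y).
Proof.
move=> dP dh; rewrite /partial deriveE; last exact: differentiable_comp.
rewrite diff_comp//= [X in 'd h _ X]row_sum_delta linear_sum/=.
apply: eq_bigr => a _; rewrite linearZ/= deriveE//; congr (_ * _).
by rewrite /jacobian /lin1_mx mxE.
Qed.

End chain_rule.

(** * Horizontal and vertical spaces of a linear surjection *)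

Section linear_algebra.
Context {R : realType}.

Definition posdef {n} (G : 'M[R]_n) :=
  forall v : 'rV[R]_n, v != 0 -> 0 < (v *m G *m v^T) 0 0.

Lemma posdef_eq0 n (G : 'M[R]_n) (v : 'rV[R]_n) : posdef G ->
  v *m G *m v^T = 0 -> v = 0.
Proof.
move=> pG vG; apply/eqP; apply: contraT => /pG.
by rewrite vG mxE ltxx.
Qed.

Lemma posdef_unitmx n (G : 'M[R]_n) : posdef G -> G \in unitmx.
Proof.
move=> pG; rewrite -row_free_unit -kermx_eq0; apply/eqP/eqP/rowV0P => v.
by move=> /sub_kermxP vG; apply: (posdef_eq0 pG); rewrite vG mul0mx.
Qed.

Lemma posdef_inv n (G : 'M[R]_n) : G^T = G -> posdef G -> posdef (invmx G).
Proof.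
move=> sG pG v v0; have uG := posdef_unitmx pG.
have := pG (v *m invmx G); rewrite trmx_mul trmx_inv sG mulmxA mulmxKV//.
apply; apply: contra v0 => /eqP vG; apply/eqP.
by rewrite -[v](mulmxKV uG) vG mul0mx.
Qed.

Lemma mx_row_form p q r s (B : 'M[R]_(p, q)) (M : 'M[R]_(q, r)) (C : 'M[R]_(s, r)) i j :
  (row i B *m M *m (row j C)^T) 0 0 = (B *m M *m C^T) i j.
Proof.
rewrite -row_mul [LHS]mxE [RHS]mxE; apply: eq_bigr => k _.
by rewrite !mxE.
Qed.

Variables (m n : nat) (G : 'M[R]_m) (D : 'M[R]_(m, n)).
Hypotheses (sG : G^T = G) (pG : posdef G) (rD : \rank D = n).
Let A := D^T *m invmx G.
Let S := A *m D.

Let uG : G \in unitmx. Proof. exact: posdef_unitmx. Qed.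

(** [D^T] is injective on row vectors because [D] has rank [n]. *)
Lemma posdef_gram : posdef S.
Proof.
move=> v v0; have := posdef_inv sG pG (v := v *m D^T).
rewrite trmx_mul trmxK /S /A !mulmxA; apply; apply: contra v0 => /eqP vD.
have fD : row_free D^T by rewrite /row_free mxrank_tr rD.
by apply/eqP; apply: (row_free_inj fD); rewrite vD mul0mx.
Qed.

Lemma gram_unitmx : S \in unitmx.
Proof. exact: posdef_unitmx posdef_gram. Qed.

Lemma gram_sym : S^T = S.
Proof. by rewrite /S /A !trmx_mul trmxK trmx_inv sG mulmxA. Qed.

Let hor := kermx (G *m (kermx D)^T).

(** The rows of [A] are the gradients of the components, and a gradient is
    orthogonal to the kernel of the differential. *)
Lemma sub_horizontal : (A <= hor)%MS.
Proof.
apply/sub_kermxP; rewrite /A mulmxA mulmxKV//.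
by rewrite -trmx_mul mulmx_ker trmx0.
Qed.

Lemma capmx_horizontal_vertical : (hor :&: kermx D = 0)%MS.
Proof.
apply/eqP/rowV0P => v; rewrite sub_capmx => /andP[/sub_kermxP vh /submxP[w vw]].
apply: (posdef_eq0 pG); rewrite {2}vw trmx_mul mulmxA.
by rewrite -(mulmxA v) vh mul0mx.
Qed.

(** [D S^-1 A] fixes the horizontal rows of [A] and [1 - D S^-1 A] has values
    in the kernel of [D]. *)
Lemma proj_horizontalE : proj_mx hor (kermx D) = D *m invmx S *m A.
Proof.
set Q := D *m invmx S *m A.
have Qh : (Q <= hor)%MS by apply: submx_trans sub_horizontal; exact: submxMl.
have Qv : (1%:M - Q <= kermx D)%MS.
  apply/sub_kermxP; rewrite mulmxBl mul1mx.
  have -> : Q *m D = D *m (invmx S *m S) by rewrite /Q /S -!mulmxA.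
  by rewrite mulVmx ?gram_unitmx// mulmx1 subrr.
have dx := capmx_horizontal_vertical.
rewrite -[LHS]mul1mx -[1%:M](subrK Q) mulmxDl.
by rewrite (proj_mx_0 dx Qv) add0r (proj_mx_id dx Qh).
Qed.

(** Conformality on the gradients, i.e. on the rows of [A], reads
    [S g S = l S]; cancel [S]. *)
Lemma conformal_gram (g : 'M[R]_n) (l : R) : posdef g ->
  (forall X Y : 'rV[R]_m, (X <= hor)%MS -> (Y <= hor)%MS ->
     (X *m D) *m g *m (Y *m D)^T = l *: (X *m G *m Y^T)) ->
  S = l *: invmx g.
Proof.
move=> pg conf.
have E : S *m g *m S^T = l *: S.
  have SE : S = A *m G *m A^T.
    by rewrite {1}/A mulmxKV// /S /A trmx_mul trmxK trmx_inv sG mulmxA.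
  apply/matrixP => i j; rewrite -mx_row_form [in RHS]SE [RHS]mxE -(mx_row_form A).
  have hA k : (row k A <= hor)%MS := submx_trans (row_sub k A) sub_horizontal.
  have := conf _ _ (hA i) (hA j); rewrite -!row_mul => ->.
  by rewrite mxE row_mul.
rewrite gram_sym in E.
have : g *m S = l%:M.
  rewrite -[LHS](mulKmx gram_unitmx) (mulmxA S) E -scalemxAr.
  by rewrite mulVmx ?gram_unitmx// scalemx1.
move=> H; have ug := posdef_unitmx pg.
by rewrite -[LHS](mulKmx ug) H -mul_mx_scalar.
Qed.

End linear_algebra.

(** * Hessian and Laplacian of a metric in coordinates *)

(** What the local computations need to know about a Riemannian metric
    near one point. *)
Definition metric_germ {R : realType} {n} (G : 'rV[R]_n -> 'M[R]_n) y :=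
  [/\ mx_differentiable G y, \forall z \near y, (G z)^T = G z &
      \forall z \near y, posdef (G z)].

(** What the second order chain rule [hessian_comp] needs. *)
Definition twice_differentiable {R : realType} {n} (f : 'rV[R]_n -> R) y :=
  (\forall z \near y, differentiable f z) /\
  forall i, differentiable (partial i f) y.

(** The covariant Hessian: the matrix of the Levi-Civita derivative of [df]. *)
Definition hessian {R : realType} {n} (G : 'rV[R]_n -> 'M[R]_n)
    (f : 'rV[R]_n -> R) y : 'M[R]_n :=
  \matrix_(p, q) (partial p (partial q f) y
                  - \sum_l christoffel G l p q y * partial l f y).

Section laplacian_trace.
Context {R : realType} {n : nat}.
Variables (G : 'rV[R]_n -> 'M[R]_n) (y : 'rV[R]_n).
Hypothesis metricG : metric_germ G y.
Let K := invmx (G y).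
Let dG i := partial_mx i G y.

Lemma metric_germ_unit : \forall z \near y, G z \in unitmx.
Proof. by have [_ _] := metricG; apply: filterS => z; exact: posdef_unitmx. Qed.

Lemma metric_germ_symV : K^T = K.
Proof. by have [_ /nbhs_singleton sG _] := metricG; rewrite /K trmx_inv sG. Qed.

Let KC p q : K p q = K q p.
Proof. by rewrite -[in LHS]metric_germ_symV mxE. Qed.

Lemma metric_germ_sym_partial i : (dG i)^T = dG i.
Proof.
have [_ sG _] := metricG.
by rewrite /dG -partial_mx_tr; apply: partial_mx_near; apply: filterS sG => z ->.
Qed.

Let dGC i p q : dG i p q = dG i q p.
Proof. by rewrite -[in LHS]metric_germ_sym_partial mxE. Qed.

Lemma christoffelE k i j : christoffel G k i j y =
  2^-1 * \sum_l K k l * (dG i j l + dG j i l - dG l i j).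
Proof.
by rewrite /christoffel; congr (_ * _); apply: eq_bigr => l _; rewrite /dG !mxE.
Qed.

Let T l := \sum_p \sum_q \sum_r K l r * K p q * dG p q r.
Let W l := \sum_p \sum_q \sum_r K l r * K p q * dG r p q.

(** [T] and [W] are the two contractions of the derivative of the metric
    through which all traces of Christoffel symbols can be written. *)
Lemma christoffel_contraction l :
  \sum_p \sum_q K p q * christoffel G l p q y = T l - 2^-1 * W l.
Proof.
have -> : T l = 2^-1 * T l + 2^-1 * T l by lra.
have {2}-> : T l = \sum_p \sum_q \sum_r K l r * K p q * dG q p r.
  rewrite /T exchange_big/=; apply: eq_bigr => p _; apply: eq_bigr => q _.
  by apply: eq_bigr => r _; rewrite (KC p q).
rewrite -mulrDr -mulrBr -big_split -sumrB/= mulr_sumr; apply: eq_bigr => p _.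
rewrite -big_split -sumrB/= mulr_sumr; apply: eq_bigr => q _.
rewrite -big_split -sumrB/= christoffelE mulrCA; congr (_ * _).
by rewrite mulr_sumr; apply: eq_bigr => r _; ring.
Qed.

Lemma christoffel_trace j :
  \sum_i christoffel G i i j y = 2^-1 * \sum_p \sum_q K p q * dG j p q.
Proof.
under eq_bigr do rewrite christoffelE.
rewrite -mulr_sumr; congr (_ * _).
under eq_bigr => i _.
  under eq_bigr do rewrite mulrBr mulrDr.
  rewrite sumrB big_split/=; over.
rewrite sumrB big_split/= [X in _ - X]exchange_big/= addrAC.
rewrite [X in X + _](_ : _ = 0) ?add0r//.
apply/eqP; rewrite subr_eq0; apply/eqP; apply: eq_bigr => p _.
by apply: eq_bigr => q _; rewrite KC (dGC p).
Qed.

(** The first order part of the divergence of a gradient equals the first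
    order part of the trace of the Hessian. *)
Lemma christoffel_divergence l :
  \sum_i partial_mx i (fun z => invmx (G z)) y l i
  + \sum_i \sum_j K l j * christoffel G i i j y
  = - \sum_p \sum_q K p q * christoffel G l p q y.
Proof.
have [dGy _ _] := metricG.
rewrite christoffel_contraction exchange_big/=.
have -> : \sum_j \sum_i K l j * christoffel G i i j y = 2^-1 * W l.
  have -> : W l = \sum_r \sum_p \sum_q K l r * K p q * dG r p q.
    by rewrite exchange_big; apply: eq_bigr => p _; rewrite exchange_big.
  rewrite mulr_sumr; apply: eq_bigr => j _.
  rewrite -mulr_sumr christoffel_trace mulrCA; congr (_ * _).
  rewrite mulr_sumr; apply: eq_bigr => p _; rewrite mulr_sumr.
  by apply: eq_bigr => q _; rewrite mulrA.
have -> : \sum_i partial_mx i (fun z => invmx (G z)) y l i = - T l.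
  rewrite -sumrN; apply: eq_bigr => p _.
  rewrite partial_mx_inv//; last exact: metric_germ_unit.
  rewrite mxE; congr (- _); rewrite mxE; apply: eq_bigr => q _.
  rewrite mxE mulr_suml; apply: eq_bigr => r _.
  by rewrite -/K -/(dG p) (KC q p) (dGC p r q) mulrAC.
by rewrite opprB addrC.
Qed.

(** The second order parts agree, and so do the first order parts by
    [christoffel_divergence]. *)
Lemma laplacian_hessian f : (forall i, differentiable (partial i f) y) ->
  laplacian G f y = \sum_p \sum_q K p q * hessian G f y p q.
Proof.
move=> df; have [dGy sG _] := metricG.
have dK := mx_differentiable_inv dGy metric_germ_unit.
have gradE : \forall z \near y, forall k,
    gradient G f z 0 k = \sum_l partial l f z * invmx (G z) l k.
  apply: filterS sG => z sGz k; rewrite mxE; apply: eq_bigr => l _.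
  have : (invmx (G z))^T k l = invmx (G z) k l by rewrite trmx_inv sGz.
  by rewrite mxE => <-; rewrite mulrC.
have dgrad i k : partial i (fun z => gradient G f z 0 k) y =
    \sum_l (partial i (partial l f) y * K l k +
            partial l f y * partial_mx i (fun z => invmx (G z)) y l k).
  rewrite (@partial_near _ _ i _ (fun z => \sum_l partial l f z * invmx (G z) l k)).
    rewrite partial_sum; last by move=> l; exact: differentiableM.
    by apply: eq_bigr => l _; rewrite mxE partialM.
  by apply: filterS gradE => z.
rewrite /laplacian /divergence.
have nablaE i : nabla G (fun=> basis_vec i) (gradient G f) y 0 i =
   \sum_l partial i (partial l f) y * K l i +
   \sum_l partial l f y * (partial_mx i (fun z => invmx (G z)) y l i
      + \sum_j K l j * christoffel G i i j y).
  rewrite mxE (bigD1 i)//= [X in _ + X + _]big1 ?addr0; last first.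
    by move=> j ji; rewrite !mxE eqxx/= (negbTE ji) mul0r.
  rewrite (bigD1 i)//= [X in _ + (_ + X)]big1 ?addr0; last first.
    by move=> j ji; apply: big1 => k _; rewrite !mxE eqxx/= (negbTE ji) !mul0r.
  rewrite !mxE !eqxx mul1r dgrad big_split/= -addrA; congr (_ + _).
  under [X in _ + X]eq_bigr => j _.
    rewrite mul1r (nbhs_singleton gradE) mulr_suml; over.
  rewrite exchange_big/= -big_split/=; apply: eq_bigr => l _.
  rewrite mulrDr mulr_sumr; congr (_ + _); apply: eq_bigr => j _.
  by rewrite [RHS]mulrA.
under eq_bigr do rewrite nablaE.
rewrite big_split/= [X in _ + X]exchange_big/=.
under [X in _ + X]eq_bigr => l _.
  rewrite -mulr_sumr big_split/= christoffel_divergence mulrN; over.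
rewrite /= sumrN.
under [RHS]eq_bigr => p _.
  under eq_bigr do rewrite mxE mulrBr.
  rewrite sumrB; over.
rewrite /= sumrB; congr (_ - _).
  by apply: eq_bigr => p _; apply: eq_bigr => q _; rewrite mulrC (KC q p).
under eq_bigr do rewrite mulr_sumr.
rewrite exchange_big/=; apply: eq_bigr => p _.
under eq_bigr do rewrite mulr_sumr.
rewrite exchange_big/=; apply: eq_bigr => q _.
rewrite mulr_sumr; apply: eq_bigr => l _.
by rewrite [LHS]mulrC -[LHS]mulrA.
Qed.

End laplacian_trace.

(** The rearrangement of sums behind [hessian_comp]. *)
Lemma hessian_comp_sums {R : realType} {m n : nat} (A B : 'I_n -> R)
    (C : 'I_n -> 'I_n -> R) (c : 'I_m -> R) (d : 'I_m -> 'I_n -> R) :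
  \sum_b (A b * B b + \sum_a C a b) - \sum_l c l * (\sum_b d l b * B b) =
  \sum_a \sum_b C a b + \sum_b B b * (A b - \sum_l c l * d l b).
Proof.
rewrite big_split/= addrAC [RHS]addrC; congr (_ + _); last exact: exchange_big.
under [X in _ - X]eq_bigr do rewrite mulr_sumr.
rewrite exchange_big/= -sumrB; apply: eq_bigr => b _.
rewrite mulrBr mulrC; congr (_ - _).
by rewrite mulr_sumr; apply: eq_bigr => l _; rewrite mulrA mulrC.
Qed.

Section hessian_composition.
Context {R : realType} {m n : nat}.
Variables (G : 'rV[R]_m -> 'M[R]_m) (P : 'rV[R]_m -> 'rV[R]_n).
Variables (h : 'rV[R]_n -> R) (y : 'rV[R]_m).
Hypotheses (dP : forall a, twice_differentiable (fun z => P z 0 a) y)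
  (dh : twice_differentiable h (P y)).

Lemma near_differentiable_rV : \forall z \near y, differentiable P z.
Proof.
have dPz : \forall z \near y, forall a, differentiable (fun z => P z 0 a) z.
  by near=> z; near: z; apply: filter_forall => a; have [] := dP a.
by apply: filterS dPz => z; exact: differentiable_rV.
Unshelve. all: by end_near. Qed.

Lemma near_differentiable_outer : \forall z \near y, differentiable h (P z).
Proof.
have [dh1 _] := dh.
have cP : {for y, continuous P}.
  exact: differentiable_continuous (nbhs_singleton near_differentiable_rV).
exact: (cP _ dh1).
Qed.

Lemma near_partial_comp q : \forall z \near y, partial q (h \o P) z =
  \sum_b partial q (fun z => P z 0 b) z * partial b h (P z).
Proof.
apply: filterS2 near_differentiable_rV near_differentiable_outer => z dPz dhz.
rewrite partial_comp//; apply: eq_bigr => b _.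
by rewrite jacobianE.
Qed.

Lemma twice_differentiable_comp : twice_differentiable (h \o P) y.
Proof.
have [dh1 dh2] := dh.
have dPy := nbhs_singleton near_differentiable_rV.
split.
  apply: filterS2 near_differentiable_rV near_differentiable_outer => z dPz dhz.
  exact: differentiable_comp.
move=> q; have := near_partial_comp q.
have d : differentiable
    (fun z => \sum_b partial q (fun z => P z 0 b) z * partial b h (P z)) y.
  apply: differentiable_fsum => b; apply: differentiableM.
    by have [_] := dP b; exact.
  by apply: differentiable_comp.
move=> E; apply: near_eq_differentiable d.
by apply: filterS E => z ->.
Qed.

Lemma hessian_comp p q : hessian G (h \o P) y p q =
  \sum_a \sum_b 'J P y p a * 'J P y q b * partial a (partial b h) (P y)
  + \sum_b partial b h (P y) * hessian G (fun z => P z 0 b) y p q.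
Proof.
have [dh1 dh2] := dh.
have dPy := nbhs_singleton near_differentiable_rV.
rewrite mxE (partial_near _ (near_partial_comp q)) partial_sum; last first.
  move=> b; apply: differentiableM; last exact: differentiable_comp.
  by have [_] := dP b; exact.
have E b : partial p (fun z => partial q (fun z => P z 0 b) z * partial b h (P z)) y =
   partial p (partial q (fun z => P z 0 b)) y * partial b h (P y) +
   \sum_a 'J P y p a * 'J P y q b * partial a (partial b h) (P y).
  rewrite partialM//; last 2 first.
  - by have [_] := dP b; exact.
  - exact: differentiable_comp.
  congr (_ + _); rewrite (partial_comp p dPy (dh2 b)) mulr_sumr.
  by apply: eq_bigr => a _; rewrite (jacobianE q b dPy) mulrA [X in X * _]mulrC.
under eq_bigr do rewrite E.
under [X in _ - X]eq_bigr do rewrite (nbhs_singleton (near_partial_comp _)).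
under [X in _ = _ + X]eq_bigr do rewrite mxE.
exact: (hessian_comp_sums (fun b => partial p (partial q (fun z => P z 0 b)) y)
  (fun b => partial b h (P y))
  (fun a b => 'J P y p a * 'J P y q b * partial a (partial b h) (P y))
  (fun l => christoffel G l p q y)
  (fun l b => partial l (fun z => P z 0 b) y)).
Qed.

End hessian_composition.

(** * Second fundamental form of the fibers *)

(** In this section [K] stands for an inverse metric, [dG p] for the [p]-th
    partial derivative of the metric, [D] for the Jacobian of a map, [E p] for
    the [p]-th partial derivative of [D], and [dS p] for the one of the Gram
    matrix [D^T K D] of the gradients; [chris] are the Christoffel symbols. *)
Section polarization_identity.
Context {R : realType} {m n : nat}.
Variables (K : 'M[R]_m) (D : 'M[R]_(m, n)).
Variables (dG : 'I_m -> 'M[R]_m) (E : 'I_m -> 'M[R]_(m, n)).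
Hypothesis (sE : forall p q a, E p q a = E q p a).
Variable A : 'M[R]_(n, m).
Hypothesis AE : A = D^T *m K.
Let e b c a := \sum_p A b p * (A *m E p) c a.
Let T b c a := \sum_p \sum_q \sum_r A b p * A c q * A a r * dG p q r.
Let dS p := (A *m E p)^T + A *m E p - A *m dG p *m A^T.
Let s b c a := \sum_p A b p * dS p c a.
Let chris l p q := 2^-1 * \sum_r K l r * (dG p q r + dG q p r - dG r p q).

Let eC b c a : e b c a = e c b a.
Proof.
rewrite /e; under eq_bigr do rewrite mxE mulr_sumr.
rewrite exchange_big; apply: eq_bigr => p _.
rewrite mxE mulr_sumr; apply: eq_bigr => q _.
by rewrite mulrCA sE.
Qed.

Let TE b c a : T b c a = \sum_p A b p * (A *m dG p *m A^T) c a.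
Proof.
apply: eq_bigr => p _; rewrite mxE mulr_sumr exchange_big/=.
apply: eq_bigr => r _; rewrite [A^T _ _]mxE mxE mulr_suml mulr_sumr.
by apply: eq_bigr => q _; ring.
Qed.

Let sE3 b c a : s b c a = e b a c + e b c a - T b c a.
Proof.
rewrite TE /s /e -big_split -sumrB; apply: eq_bigr => p _ /=.
by rewrite !mxE; ring.
Qed.

Let chrisD p q a : \sum_l chris l p q * D l a =
  2^-1 * \sum_r A a r * (dG p q r + dG q p r - dG r p q).
Proof.
rewrite /chris; under eq_bigr do rewrite -mulrA mulr_suml.
rewrite -mulr_sumr exchange_big/=; congr (_ * _); apply: eq_bigr => r _.
rewrite AE mxE mulr_suml; apply: eq_bigr => l _.
by rewrite mxE; ring.
Qed.

Lemma polarization b c a :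
  \sum_p \sum_q A b p * A c q * (E p q a - \sum_l chris l p q * D l a) =
  2^-1 * (s b c a + s c b a - s a b c).
Proof.
have -> : 2^-1 * (s b c a + s c b a - s a b c) =
    e b c a - 2^-1 * (T b c a + T c b a - T a b c).
  by rewrite !sE3 (eC a b c) (eC a c b) (eC c b a); field.
have -> : T c b a = \sum_p \sum_q \sum_r A b p * A c q * A a r * dG q p r.
  rewrite /T exchange_big; apply: eq_bigr => p _; apply: eq_bigr => q _.
  by apply: eq_bigr => r _; rewrite [A c q * _]mulrC.
have -> : T a b c = \sum_p \sum_q \sum_r A b p * A c q * A a r * dG r p q.
  rewrite /T exchange_big; apply: eq_bigr => p _ /=.
  rewrite exchange_big; apply: eq_bigr => q _; apply: eq_bigr => r _ /=.
  by rewrite mulrC [in RHS]mulrC; congr (_ * _); ring.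
rewrite /T -big_split -sumrB mulr_sumr/= -sumrB; apply: eq_bigr => p _.
rewrite mxE mulr_sumr -big_split -sumrB mulr_sumr/= -sumrB; apply: eq_bigr => q _.
rewrite chrisD -big_split -sumrB/= mulrBr mulrA; congr (_ - _).
rewrite mulrCA; congr (_ * _); rewrite mulr_sumr; apply: eq_bigr => r _.
by ring.
Qed.

End polarization_identity.

(** Here [g] is the metric of the target and [dk d] the derivatives of its
    inverse [k]; [L b] is the derivative of the squared dilation [l2] along the
    gradient of the [b]-th component. *)
Section conformal_trace.
Context {R : realType} {n : nat}.
Variables (g k : 'M[R]_n) (dk : 'I_n -> 'M[R]_n) (L : 'I_n -> R) (l2 : R).
Hypotheses (kg : k *m g = 1%:M) (sk : k^T = k) (sg : g^T = g) (l20 : l2 != 0).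
Hypothesis (sdk : forall d, (dk d)^T = dk d).
Let s b c a := L b * k c a + l2 ^+ 2 * \sum_d k b d * dk d c a.

Lemma conformal_contraction a :
  \sum_b \sum_c (l2^-1 * g b c) * (2^-1 * (s b c a + s c b a - s a b c)) =
  (2 - n%:R) / (2 * l2) * L a
  + l2 * (\sum_c dk c a c
          - 2^-1 * \sum_d k a d * \sum_b \sum_c g b c * dk d b c).
Proof.
have gk : g *m k = 1%:M by exact: mulmx1C.
have gC b c : g b c = g c b by rewrite -[in LHS]sg mxE.
have kC b c : k b c = k c b by rewrite -[in LHS]sk mxE.
have gkE b c : \sum_j g b j * k j c = (b == c)%:R.
  by have /matrixP/(_ b c) := gk; rewrite !mxE.
have X1 (F : 'I_n -> R) : \sum_b F b * (b == a)%:R = F a.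
  rewrite (bigD1 a)//= eqxx mulr1 big1 ?addr0// => b /negbTE ->.
  by rewrite mulr0.
have S1 : \sum_b \sum_c g b c * s b c a = L a + l2 ^+ 2 * \sum_c dk c a c.
  rewrite /s; under eq_bigr => b _.
    under eq_bigr do rewrite mulrDr.
    rewrite big_split/=.
    under eq_bigr do rewrite mulrCA.
    rewrite -mulr_sumr gkE; over.
  rewrite big_split/= X1; congr (_ + _).
  rewrite exchange_big mulr_sumr/=; apply: eq_bigr => c _.
  under eq_bigr do rewrite mulrCA.
  rewrite -mulr_sumr; congr (_ * _).
  under eq_bigr do rewrite mulr_sumr.
  rewrite exchange_big/=.
  under eq_bigr => d _.
    under eq_bigr do rewrite mulrA gC.
    rewrite -mulr_suml gkE mulrC; over.
  rewrite /= (bigD1 c)//= eqxx mulr1 big1 ?addr0.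
    by rewrite -[in LHS]sdk mxE.
  by move=> d; rewrite eq_sym => /negbTE ->; rewrite mulr0.
have S2 : \sum_b \sum_c g b c * s c b a = L a + l2 ^+ 2 * \sum_c dk c a c.
  rewrite -S1 exchange_big; apply: eq_bigr => b _; apply: eq_bigr => c _.
  by rewrite gC.
have S3 : \sum_b \sum_c g b c * s a b c = n%:R * L a +
    l2 ^+ 2 * \sum_d k a d * \sum_b \sum_c g b c * dk d b c.
  rewrite /s; under eq_bigr => b _.
    under eq_bigr do rewrite mulrDr.
    rewrite big_split/=.
    under eq_bigr do rewrite mulrCA kC.
    rewrite -mulr_sumr gkE eqxx mulr1; over.
  rewrite big_split/= sumr_const card_ord mulr_natl; congr (_ + _).
  under eq_bigr => b _.
    under eq_bigr do rewrite mulrCA mulr_sumr.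
    rewrite -mulr_sumr exchange_big/=; over.
  rewrite -mulr_sumr exchange_big/=; congr (_ * _); apply: eq_bigr => d _.
  rewrite mulr_sumr; apply: eq_bigr => b _; rewrite mulr_sumr.
  by apply: eq_bigr => c _; rewrite mulrCA.
transitivity (l2^-1 * (2^-1 * (\sum_b \sum_c g b c * s b c a +
   \sum_b \sum_c g b c * s c b a - \sum_b \sum_c g b c * s a b c))).
  rewrite -big_split -sumrB !mulr_sumr; apply: eq_bigr => b _ /=.
  rewrite -big_split -sumrB !mulr_sumr; apply: eq_bigr => c _ /=.
  by ring.
rewrite S1 S2 S3.
move: (\sum_c dk c a c) (\sum_d _) => x y.
by field.
Qed.

End conformal_trace.

(** [V] is the projection onto the vertical space, and [A V = 0], so that
    [V^T K V] is [K] minus its horizontal part. *)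
Lemma vertical_gram {R : realType} {m n : nat} (K : 'M[R]_m) (D : 'M[R]_(m, n))
    (S : 'M[R]_n) :
  K^T = K -> S = D^T *m K *m D -> S \in unitmx ->
  let A := D^T *m K in
  let V := 1%:M - D *m invmx S *m A in
  V^T *m K *m V = K - A^T *m invmx S *m A.
Proof.
move=> sK SE uS A V.
have AK : A^T = K *m D by rewrite /A trmx_mul trmxK sK.
have sS : S^T = S by rewrite SE !trmx_mul trmxK sK mulmxA.
have AV : A *m V = 0.
  rewrite /V mulmxBr mulmx1 !mulmxA (_ : A *m D = S) ?SE// -SE.
  by rewrite mulmxV// mul1mx subrr.
have KV : K *m V = K - A^T *m (invmx S *m A).
  by rewrite /V mulmxBr mulmx1 AK !mulmxA.
rewrite -mulmxA KV mulmxBr (mulmxA V^T A^T) -trmx_mul AV trmx0 mul0mx subr0.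
have -> : V^T = 1%:M - A^T *m invmx S *m D^T.
  rewrite /V [LHS](raddfB (@trmx R _ _)) /= trmx1 !trmx_mul trmx_inv sS.
  by rewrite mulmxA.
by rewrite mulmxBl mul1mx -(mulmxA _ D^T).
Qed.

Lemma trace_congruence {R : realType} {m : nat} (V K H : 'M[R]_m) :
  \sum_i \sum_j K i j * \sum_p \sum_q V i p * V j q * H p q =
  \sum_p \sum_q (V^T *m K *m V) p q * H p q.
Proof.
under eq_bigr => i _.
  under eq_bigr => j _.
    rewrite mulr_sumr.
    under eq_bigr do rewrite mulr_sumr.
    over.
  rewrite exchange_big/=.
  under eq_bigr do rewrite exchange_big/=.
  over.
rewrite exchange_big/=; apply: eq_bigr => p _.
rewrite exchange_big/=; apply: eq_bigr => q _.
rewrite exchange_big/= mxE mulr_suml; apply: eq_bigr => j _.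
rewrite mxE !mulr_suml; apply: eq_bigr => i _.
by rewrite mxE; ring.
Qed.

(** Splits a trace over the whole tangent space into its vertical and
    horizontal parts, [T] being the inverse Gram matrix of the rows of [A]. *)
Lemma trace_complement {R : realType} {m n : nat} (K H : 'M[R]_m)
    (A : 'M[R]_(n, m)) (T : 'M[R]_n) :
  - (\sum_p \sum_q (K - A^T *m T *m A) p q * H p q) =
  \sum_b \sum_c T b c * (\sum_p \sum_q A b p * A c q * H p q)
  - \sum_p \sum_q K p q * H p q.
Proof.
have -> : \sum_b \sum_c T b c * (\sum_p \sum_q A b p * A c q * H p q) =
   \sum_p \sum_q (A^T *m T *m A) p q * H p q.
  under eq_bigr => b _.
    under eq_bigr => c _.
      rewrite mulr_sumr.
      under eq_bigr do rewrite mulr_sumr.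
      over.
    rewrite exchange_big/=.
    under eq_bigr do rewrite exchange_big/=.
    over.
  rewrite exchange_big/=; apply: eq_bigr => p _.
  rewrite exchange_big/=; apply: eq_bigr => q _.
  rewrite exchange_big/= mxE mulr_suml; apply: eq_bigr => c _.
  rewrite mxE !mulr_suml; apply: eq_bigr => b _.
  by rewrite mxE; ring.
rewrite -sumrN -sumrB; apply: eq_bigr => p _.
rewrite -sumrN -sumrB; apply: eq_bigr => q _.
by rewrite !mxE mulrBl opprB.
Qed.

Section fibers.
Context {R : realType} {m n : nat}.
Variables (G : 'rV[R]_m -> 'M[R]_m) (P : 'rV[R]_m -> 'rV[R]_n) (y : 'rV[R]_m).
Hypothesis metricG : metric_germ G y.
Hypothesis dP : forall a, twice_differentiable (fun z => P z 0 a) y.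
Hypothesis symP : forall a p q, partial p (partial q (fun z => P z 0 a)) y =
  partial q (partial p (fun z => P z 0 a)) y.
Hypothesis rankP : \forall z \near y, \rank ('J P z) = n.

Let K := invmx (G y).
Let D := 'J P y.
Let A := D^T *m K.
Let S z := ('J P z)^T *m invmx (G z) *m 'J P z.
Let H a := hessian G (fun z => P z 0 a) y.
Let V := vproj G P.

Let jacE : \forall z \near y, forall q a, 'J P z q a = partial q (fun z => P z 0 a) z.
Proof.
have dPz := near_differentiable_rV dP.
by apply: filterS dPz => z {}dPz q a; rewrite jacobianE.
Qed.

Lemma mx_differentiable_jacobian : mx_differentiable (fun z => 'J P z) y.
Proof.
move=> q a; have [_ /(_ q) d] := dP a.
by apply: near_eq_differentiable d; apply: filterS jacE => z ->.
Qed.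

Lemma partial_mx_jacobian p q a : partial_mx p (fun z => 'J P z) y q a =
  partial p (partial q (fun z => P z 0 a)) y.
Proof. by rewrite mxE; apply: partial_near; apply: filterS jacE => z ->. Qed.

Lemma mx_differentiable_gram : mx_differentiable S y.
Proof.
have [dG _ _] := metricG; have dJ := mx_differentiable_jacobian.
apply: mx_differentiableM => //; apply: mx_differentiableM.
  exact: mx_differentiable_tr.
exact: mx_differentiable_inv dG (metric_germ_unit metricG).
Qed.

Let dG p := partial_mx p G y.
Let E p := partial_mx p (fun z => 'J P z) y.

(** The derivative of [K] has been replaced by [- K dG K], which is why the
    metric itself occurs on the right. *)
Lemma partial_gram p : partial_mx p S y =
  (A *m E p)^T + A *m E p - A *m dG p *m A^T.
Proof.
have [ddG _ _] := metricG; have dJ := mx_differentiable_jacobian.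
have uG := metric_germ_unit metricG.
have dK := mx_differentiable_inv ddG uG.
have dJT := mx_differentiable_tr dJ.
rewrite partial_mxM//; last exact: mx_differentiableM.
rewrite partial_mxM// partial_mx_tr partial_mx_inv// -/(dG p) -/(E p) -/K -/D.
have sK : K^T = K := metric_germ_symV metricG.
rewrite mulmxDl mulmxN mulNmx addrAC; congr (_ + _ - _).
  by rewrite /A !trmx_mul sK trmxK mulmxA.
by rewrite /A trmx_mul trmxK sK !mulmxA.
Qed.

Let hessE a p q : H a p q =
  E p q a - \sum_l christoffel G l p q y * D l a.
Proof.
rewrite mxE partial_mx_jacobian; congr (_ - _); apply: eq_bigr => l _.
by rewrite /D (nbhs_singleton jacE).
Qed.

(** In [S b c = <grad P_b, grad P_c>] the derivative of each factor is a
    Hessian, so the derivatives of [S] are sums of two Hessians of components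
    evaluated on gradients; symmetry of the Hessian allows to solve for one. *)
Lemma hessian_gram a b c :
  \sum_p \sum_q A b p * A c q * H a p q =
  2^-1 * (\sum_p A b p * partial_mx p S y c a
        + \sum_p A c p * partial_mx p S y b a
        - \sum_p A a p * partial_mx p S y b c).
Proof.
have symE p q i : E p q i = E q p i.
  exact: etrans (partial_mx_jacobian p q i)
    (etrans (symP i p q) (esym (partial_mx_jacobian q p i))).
have Q := @polarization R m n K D dG E symE A (erefl _) b c a.
under eq_bigr do under eq_bigr do rewrite hessE.
under [X in _ = _ * (X + _ - _)]eq_bigr do rewrite partial_gram.
under [X in _ = _ * (_ + X - _)]eq_bigr do rewrite partial_gram.
under [X in _ = _ * (_ - X)]eq_bigr do rewrite partial_gram.
rewrite -Q; apply: eq_bigr => p _; apply: eq_bigr => q _.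
congr (_ * (_ - _)); apply: eq_bigr => l _; congr (_ * _).
exact: christoffelE.
Qed.

Lemma near_hproj : \forall z \near y,
  hproj G P z = 'J P z *m invmx (S z) *m (('J P z)^T *m invmx (G z)).
Proof.
have [_ sG pG] := metricG.
by apply: filterS3 sG pG rankP => z; exact: proj_horizontalE.
Qed.

Lemma near_gram_unit : \forall z \near y, S z \in unitmx.
Proof.
have [_ sG pG] := metricG.
by apply: filterS3 sG pG rankP => z; exact: gram_unitmx.
Qed.

Lemma near_hprojK : \forall z \near y, hproj G P z *m 'J P z = 'J P z.
Proof.
apply: filterS2 near_hproj near_gram_unit => z -> uS.
have -> : 'J P z *m invmx (S z) *m (('J P z)^T *m invmx (G z)) *m 'J P z =
    'J P z *m (invmx (S z) *m S z) by rewrite /S !mulmxA.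
by rewrite mulVmx// mulmx1.
Qed.

Lemma mx_differentiable_vproj : mx_differentiable V y.
Proof.
have [dG0 _ _] := metricG; have dJ := mx_differentiable_jacobian.
apply: mx_differentiableB; first exact: mx_differentiable_cst.
have d : mx_differentiable
    (fun z => 'J P z *m invmx (S z) *m (('J P z)^T *m invmx (G z))) y.
  apply: mx_differentiableM; apply: mx_differentiableM => //.
  - exact: mx_differentiable_inv mx_differentiable_gram near_gram_unit.
  - exact: mx_differentiable_tr.
  - exact: mx_differentiable_inv dG0 (metric_germ_unit metricG).
by apply: mx_differentiable_near d; apply: filterS near_hproj => z ->.
Qed.

Let VD : V y *m D = 0.
Proof. by rewrite mulmxBl mul1mx (nbhs_singleton near_hprojK) subrr. Qed.

Let dVD p : partial_mx p V y *m D = - (V y *m E p).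
Proof.
have dJ := mx_differentiable_jacobian; have dV := mx_differentiable_vproj.
have : partial_mx p (fun z => V z *m 'J P z) y = 0.
  rewrite -(partial_mx_cst p 0 y); apply: partial_mx_near.
  by apply: filterS near_hprojK => z hK; rewrite mulmxBl mul1mx hK subrr.
by rewrite partial_mxM// => /eqP; rewrite addr_eq0 => /eqP.
Qed.

(** Differentiating [V D = 0], that is, the fact that the components of [P] are
    constant along vertical fields, trades the derivative of the vertical fields
    for the derivative of [D]. *)
Lemma second_fundamental_form_hessian i j a :
  (second_fundamental_form G P (fun=> basis_vec i) (fun=> basis_vec j) y *m D) 0 a
  = - \sum_p \sum_q V y i p * V y j q * H a p q.
Proof.
have rowV z k r : (basis_vec k *m V z) 0 r = V z k r.
  by rewrite /basis_vec -rowE mxE.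
rewrite /second_fundamental_form -mulmxA (nbhs_singleton near_hprojK) mxE.
have nablaE k : nabla G (fun z => basis_vec i *m V z) (fun z => basis_vec j *m V z) y 0 k
   = \sum_p (V y i p * partial_mx p V y j k +
       \sum_q V y i p * V y j q * christoffel G k p q y).
  rewrite [RHS]big_split/= mxE.
  refine (f_equal2 +%R _ _).
    apply: eq_bigr => p _; refine (f_equal2 *%R (rowV y i p) _).
    rewrite mxE; refine (f_equal (fun f => partial p f y) _).
    by apply/funext => z; exact: rowV.
  apply: eq_bigr => p _; apply: eq_bigr => q _.
  exact: (f_equal2 *%R (f_equal2 *%R (rowV y i p) (rowV y j q)) erefl).
under eq_bigr do rewrite nablaE mulr_suml.
rewrite exchange_big/= -sumrN; apply: eq_bigr => p _.
under eq_bigr do rewrite mulrDl -mulrA mulr_suml.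
rewrite big_split/= -mulr_sumr.
have -> : \sum_k partial_mx p V y j k * D k a = - \sum_q V y j q * E p q a.
  have /matrixP/(_ j a) := dVD p; rewrite mxE => ->.
  by rewrite mxE mxE.
rewrite exchange_big/= mulrN mulr_sumr -sumrN -big_split/= -sumrN.
apply: eq_bigr => q _; rewrite hessE mulrBr opprB addrC mulrA; congr (_ - _).
by rewrite mulr_sumr; apply: eq_bigr => k _; rewrite [RHS]mulrA.
Qed.

Lemma vproj_gram : (V y)^T *m K *m V y = K - A^T *m invmx (S y) *m A.
Proof.
rewrite /V /vproj (nbhs_singleton near_hproj).
apply: vertical_gram; [exact: metric_germ_symV metricG|by []|].
exact: nbhs_singleton near_gram_unit.
Qed.

Lemma trace_second_fundamental_form a :
  ((\sum_i \sum_j K i j *: second_fundamental_form G P (fun=> basis_vec i)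
      (fun=> basis_vec j) y) *m D) 0 a =
  \sum_b \sum_c invmx (S y) b c * (\sum_p \sum_q A b p * A c q * H a p q)
  - \sum_p \sum_q K p q * H a p q.
Proof.
transitivity (- \sum_p \sum_q ((V y)^T *m K *m V y) p q * H a p q); last first.
  rewrite vproj_gram; exact: trace_complement.
rewrite mulmx_suml summxE -(@trace_congruence _ _ (V y)) -sumrN.
apply: eq_bigr => i _; rewrite mulmx_suml summxE -sumrN.
apply: eq_bigr => j _; rewrite -scalemxAl mxE second_fundamental_form_hessian.
by rewrite mulrN.
Qed.

(** When [m = n] the factor [(m - n)^-1] in the mean curvature is zero, but
    then the vertical spaces are zero too and both sides vanish. *)
Lemma mean_curvature_hessian a :
  (m%:R - n%:R) * (mean_curvature G P y *m D) 0 a =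
  \sum_b \sum_c invmx (S y) b c * (\sum_p \sum_q A b p * A c q * H a p q)
  - \sum_p \sum_q K p q * H a p q.
Proof.
rewrite -trace_second_fundamental_form /mean_curvature -scalemxAl [X in _ * X]mxE.
have [mn|mn] := eqVneq (m%:R : R) n%:R; last by rewrite mulVKf// subr_eq0.
rewrite mn subrr mul0r -/K.
have V0 : V y = 0.
  have /eqP : (m%:R == n%:R :> R) by apply/eqP.
  move=> /eqP; rewrite eqr_nat => /eqP mn'.
  apply/eqP; rewrite -submx0.
  have k0 : kermx D = 0.
    apply/eqP; rewrite -mxrank_eq0 mxrank_ker (nbhs_singleton rankP).
    by rewrite [X in (X - _)%N]mn' subnn.
  by rewrite -k0; apply/sub_kermxP; exact: VD.
rewrite mulmx_suml summxE big1// => i _; rewrite mulmx_suml summxE big1// => j _.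
rewrite -scalemxAl mxE second_fundamental_form_hessian V0.
rewrite big1 ?oppr0 ?mulr0// => p _; rewrite big1// => q _.
by rewrite !mxE !mul0r.
Qed.

End fibers.

(** * The Laplacian of a function composed with a harmonic morphism *)

Lemma partial_ln {R : realType} {n} (f : 'rV[R]_n -> R) y i :
  differentiable f y -> 0 < f y ->
  partial i (fun z => ln (f z)) y = partial i f y / f y.
Proof.
move=> df f0.
have dln : is_derive (f y) 1 (@ln R) (f y)^-1 by exact: is_derive1_ln.
have dl : differentiable (@ln R) (f y) by apply/derivable1_diffP; case: dln.
rewrite /partial [in LHS]deriveE; last exact: differentiable_comp.
rewrite (diff_comp df dl)/= diff1E// derive1E derive_val.
by rewrite [in RHS]deriveE.
Qed.

Lemma sum_mul_mxtrace {R : realType} {n : nat} (M N : 'M[R]_n) :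
  \sum_b \sum_c M b c * N b c = \tr (M^T *m N).
Proof.
rewrite /mxtrace exchange_big/=; apply: eq_bigr => c _; rewrite mxE.
by apply: eq_bigr => b _; rewrite mxE.
Qed.

Lemma partial_coord {R : realType} {n : nat} (l a : 'I_n) :
  partial l (fun z : 'rV[R]_n => z 0 a) = cst (l == a)%:R.
Proof.
apply/funext => z.
have did : derivable (@id 'rV[R]_n) z (basis_vec l) by exact: derivable_id.
have := derive_mx did.
by rewrite derive_id => /matrixP/(_ 0 a); rewrite !mxE/= eq_sym => ->.
Qed.

Lemma twice_differentiable_coord {R : realType} {n : nat} (a : 'I_n) (w : 'rV[R]_n) :
  twice_differentiable (fun z : 'rV[R]_n => z 0 a) w.
Proof.
split; first by near=> z; exact: differentiable_coord.
by move=> l; rewrite partial_coord; exact: differentiable_cst.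
Unshelve. all: by end_near. Qed.

Lemma jacobian_id {R : realType} {n : nat} (w : 'rV[R]_n) :
  'J (fun z : 'rV[R]_n => z) w = 1%:M.
Proof.
apply/matrixP => i a; rewrite jacobianE; last first.
  by apply: differentiable_rV => b; exact: differentiable_coord.
by rewrite partial_coord mxE.
Qed.

(** The rearrangement of sums behind [laplacian_comp_expansion]. *)
Lemma sum_bilinear {R : realType} {m n : nat} (K : 'M[R]_m) (D : 'M[R]_(m, n))
    (h2 : 'I_n -> 'I_n -> R) (h1 : 'I_n -> R) (H : 'I_n -> 'M[R]_m) :
  \sum_p \sum_q K p q * (\sum_a \sum_b D p a * D q b * h2 a b
                         + \sum_b h1 b * H b p q) =
  \sum_a \sum_b (D^T *m K *m D) a b * h2 a b
  + \sum_b h1 b * \sum_p \sum_q K p q * H b p q.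
Proof.
under eq_bigr => p _.
  under eq_bigr do rewrite mulrDr.
  rewrite big_split/=; over.
rewrite big_split/=; congr (_ + _); last first.
  under eq_bigr => p _.
    under eq_bigr do rewrite mulr_sumr.
    rewrite exchange_big/=; over.
  rewrite exchange_big/=; apply: eq_bigr => b _; rewrite mulr_sumr.
  apply: eq_bigr => p _; rewrite mulr_sumr; apply: eq_bigr => q _.
  by rewrite mulrCA.
under eq_bigr => p _.
  under eq_bigr => q _.
    rewrite mulr_sumr.
    under eq_bigr do rewrite mulr_sumr.
    over.
  rewrite exchange_big/=.
  under eq_bigr do rewrite exchange_big/=.
  over.
rewrite exchange_big/=; apply: eq_bigr => a _.
rewrite exchange_big/=; apply: eq_bigr => b _.
rewrite exchange_big/= [in RHS]mxE mulr_suml; apply: eq_bigr => q _.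
rewrite [in RHS]mxE !mulr_suml; apply: eq_bigr => p _.
by rewrite [in RHS]mxE; ring.
Qed.

(** Trace of [hessian_comp]. *)
Lemma laplacian_comp_expansion {R : realType} {m n : nat} (G : 'rV[R]_m -> 'M[R]_m)
    (P : 'rV[R]_m -> 'rV[R]_n) (h : 'rV[R]_n -> R) (y : 'rV[R]_m) :
  metric_germ G y -> (forall a, twice_differentiable (fun z => P z 0 a) y) ->
  twice_differentiable h (P y) ->
  laplacian G (h \o P) y =
  \sum_a \sum_b (('J P y)^T *m invmx (G y) *m 'J P y) a b
     * partial a (partial b h) (P y)
  + \sum_b partial b h (P y) * laplacian G (fun z => P z 0 b) y.
Proof.
move=> metricG dP dh.
rewrite (laplacian_hessian metricG); last by case: (twice_differentiable_comp dP dh).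
under eq_bigr do under eq_bigr do rewrite (hessian_comp G dP dh).
under [X in _ = _ + X]eq_bigr => b _.
  rewrite (laplacian_hessian metricG); last by case: (dP b).
  over.
exact: (sum_bilinear (invmx (G y)) ('J P y)
  (fun a b => partial a (partial b h) (P y)) (fun b => partial b h (P y))
  (fun b => hessian G (fun z => P z 0 b) y)).
Qed.

(** The Laplacian of a coordinate function in terms of the inverse metric
    alone, the form in which [conformal_contraction] produces it. *)
Lemma laplacian_coordinate_function {R : realType} {n : nat} (g : 'rV[R]_n -> 'M[R]_n)
    (w : 'rV[R]_n) (a : 'I_n) :
  metric_germ g w ->
  let k := invmx (g w) in
  let dk d := partial_mx d (fun z => invmx (g z)) w in
  laplacian g (fun z => z 0 a) w =
  \sum_c dk c a c - 2^-1 * \sum_d k a d * \sum_b \sum_c g w b c * dk d b c.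
Proof.
move=> metricg k dk.
have [dg /nbhs_singleton sg _] := metricg.
have sk : k^T = k := metric_germ_symV metricg.
have ug := metric_germ_unit metricg.
rewrite laplacian_hessian//; last first.
  by case: (twice_differentiable_coord a w).
have hessE p q : hessian g (fun z => z 0 a) w p q = - christoffel g a p q w.
  rewrite mxE partial_coord partial_cst sub0r (bigD1 a)//= partial_coord /= eqxx mulr1.
  by rewrite big1 ?addr0// => l /negbTE la; rewrite partial_coord /= la mulr0.
under eq_bigr do under eq_bigr do rewrite hessE mulrN.
under eq_bigr do rewrite sumrN.
rewrite sumrN -christoffel_divergence//; congr (_ + _).
rewrite exchange_big mulr_sumr -sumrN; apply: eq_bigr => d _ /=.
rewrite -mulr_sumr (christoffel_trace metricg) !sum_mul_mxtrace sk sg.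
rewrite mulrCA -mulrN -mulrN; congr (_ * (_ * _)).
rewrite /dk partial_mx_inv// mulmxN raddfN opprK/= !(mulmxA (g w)).
by rewrite mulmxV ?mul1mx 1?mxtrace_mulC// (nbhs_singleton ug).
Qed.

Section conformal.
Context {R : realType} {m n : nat}.
Variables (G : 'rV[R]_m -> 'M[R]_m) (P : 'rV[R]_m -> 'rV[R]_n).
Variables (g : 'rV[R]_n -> 'M[R]_n) (lam : 'rV[R]_m -> R) (y : 'rV[R]_m).
Hypothesis metricG : metric_germ G y.
Hypothesis dP : forall a, twice_differentiable (fun z => P z 0 a) y.
Hypothesis symP : forall a p q, partial p (partial q (fun z => P z 0 a)) y =
  partial q (partial p (fun z => P z 0 a)) y.
Hypothesis rankP : \forall z \near y, \rank ('J P z) = n.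
Hypothesis metricg : metric_germ g (P y).
Hypothesis lam_gt0 : forall z, 0 < lam z.
Hypothesis confP : \forall z \near y, forall X Y : 'rV[R]_m,
  (X <= horizontal G P z)%MS -> (Y <= horizontal G P z)%MS ->
  (X *m 'J P z) *m g (P z) *m (Y *m 'J P z)^T = lam z ^+ 2 *: (X *m G z *m Y^T).

Let D := 'J P y.
Let A := D^T *m invmx (G y).
Let S z := ('J P z)^T *m invmx (G z) *m 'J P z.
Let k := invmx (g (P y)).
Let dk d := partial_mx d (fun w => invmx (g w)) (P y).
Let l2 z := lam z ^+ 2.

Let dPy : differentiable P y.
Proof. exact: nbhs_singleton (near_differentiable_rV dP). Qed.

Let cP : {for y, continuous P}.
Proof. exact: differentiable_continuous. Qed.

Let near_unitg : \forall z \near y, g (P z) \in unitmx.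
Proof. exact: (cP (metric_germ_unit metricg)). Qed.

Lemma near_gramE : \forall z \near y, S z = l2 z *: invmx (g (P z)).
Proof.
have [_ sG pG] := metricG; have [_ _ pg] := metricg.
have pgP : \forall z \near y, posdef (g (P z)) by exact: (cP pg).
near=> z; apply: (@conformal_gram R m n (G z) ('J P z)).
- by near: z; exact: sG.
- by near: z; exact: pG.
- by near: z; exact: rankP.
- by near: z; exact: pgP.
- by near: z; exact: confP.
Unshelve. all: by end_near. Qed.

Let dgP : mx_differentiable (fun z => g (P z)) y.
Proof.
have [dg _ _] := metricg.
move=> a b.
by apply: (@differentiable_comp _ _ _ _ P (fun w => g w a b)) => //; exact: dg.
Qed.

Let dkP : mx_differentiable (fun z => invmx (g (P z))) y.
Proof. exact: mx_differentiable_inv. Qed.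

Lemma partial_inv_comp p : partial_mx p (fun z => invmx (g (P z))) y =
  \sum_d D p d *: dk d.
Proof.
have [dg _ _] := metricg.
have dkg := mx_differentiable_inv dg (metric_germ_unit metricg).
apply/matrixP => a b; rewrite mxE summxE.
rewrite (@partial_comp _ _ _ P (fun w => invmx (g w) a b))//.
by apply: eq_bigr => d _; rewrite !mxE.
Qed.

(** The trace of [S g = l2 1] exhibits [n l2] as a differentiable function. *)
Lemma dilation_differentiable : (0 < n)%N -> differentiable l2 y.
Proof.
move=> n0.
have n0' : n%:R != 0 :> R by rewrite pnatr_eq0 -lt0n.
have dS := mx_differentiable_gram metricG dP.
have d : differentiable (fun z => n%:R^-1 * \tr (S z *m g (P z))) y.
  apply: differentiableM; first exact: differentiable_cst.
  apply: differentiable_fsum => a.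
  exact: (mx_differentiableM dS dgP).
apply: near_eq_differentiable d.
apply: filterS2 near_gramE near_unitg => z -> ug.
by rewrite -scalemxAl mulVmx// mxtraceZ mxtrace1 mulrCA mulVf// mulr1.
Qed.

Lemma partial_gram_conformal p : (0 < n)%N ->
  partial_mx p S y = partial p l2 y *: k + l2 y *: \sum_d D p d *: dk d.
Proof.
move=> n0; rewrite (partial_mx_near p near_gramE).
rewrite (partial_mxZ p (dilation_differentiable n0) dkP).
by rewrite partial_inv_comp.
Qed.

Let L b := \sum_p A b p * partial p l2 y.

(** [S = l2 k o P], and since [A D = S] the derivative of [k o P] along
    [grad P_b] is [l2] times the derivative of [k] along the row [b] of [k]. *)
Lemma along_gram b c a : (0 < n)%N ->
  \sum_p A b p * partial_mx p S y c a =
  L b * k c a + l2 y ^+ 2 * \sum_d k b d * dk d c a.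
Proof.
move=> n0.
have SE p : partial_mx p S y c a =
    partial p l2 y * k c a + l2 y * \sum_d D p d * dk d c a.
  rewrite partial_gram_conformal// [LHS]mxE; congr (_ + _); first by rewrite mxE.
  rewrite mxE summxE; congr (_ * _); apply: eq_bigr => d _.
  by rewrite [LHS]mxE.
have Sbd d : l2 y * k b d = \sum_p A b p * D p d.
  have := nbhs_singleton near_gramE => /matrixP/(_ b d).
  by rewrite [in RHS]mxE => <-; rewrite /S [LHS]mxE.
under eq_bigr do rewrite SE mulrDr mulrA mulrCA.
rewrite big_split/= -mulr_suml; congr (_ + _).
rewrite -mulr_sumr expr2 -mulrA; congr (_ * _); rewrite mulr_sumr.
under [RHS]eq_bigr do rewrite mulrA Sbd mulr_suml.
rewrite [RHS]exchange_big/=; apply: eq_bigr => p _.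
by rewrite mulr_sumr; apply: eq_bigr => d _; rewrite mulrA.
Qed.

Let partial_ln_dilation i : (0 < n)%N ->
  partial i (fun z => ln (lam z)) y = (2 * l2 y)^-1 * partial i l2 y.
Proof.
move=> n0; have dl2 := dilation_differentiable n0.
have l20 : 0 < l2 y by rewrite exprn_gt0.
have -> : (fun z => ln (lam z)) = (fun z => cst 2^-1 z * ln (l2 z)).
  by apply/funext => z; rewrite /l2/= lnXn// -(mulr_natl (ln (lam z))) mulKf// pnatr_eq0.
have dl : differentiable (fun z => ln (l2 z)) y.
  apply: (differentiable_comp dl2); apply/derivable1_diffP.
  by case: (is_derive1_ln l20).
rewrite (partialM i (differentiable_cst _ _) dl).
rewrite partial_cst mul0r add0r partial_ln//=.
by rewrite (invfM 2 (l2 y)) -[RHS]mulrA [in RHS](mulrC (l2 y)^-1).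
Qed.

Hypothesis harmP : (n%:R - 2) *: (gradient G (fun z => ln (lam z)) y *m hproj G P y)
  + (m%:R - n%:R) *: mean_curvature G P y = 0.

(** The equation of a harmonic morphism enters here, after multiplication by
    [D]: this removes the horizontal projection and turns the mean curvature
    into traces of Hessians ([mean_curvature_hessian]). *)
Lemma laplacian_component a : laplacian G (fun z => P z 0 a) y =
  l2 y * laplacian g (fun w => w 0 a) (P y).
Proof.
have n0 : (0 < n)%N by apply: leq_ltn_trans (ltn_ord a).
have l20 : l2 y != 0 by rewrite /l2 expf_neq0// gt_eqF.
have ug := nbhs_singleton (metric_germ_unit metricg).
have sk : k^T = k := metric_germ_symV metricg.
have [dg /nbhs_singleton sg _] := metricg.
have sdk d : (dk d)^T = dk d.
  rewrite /dk -partial_mx_tr; apply: partial_mx_near.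
  by have [_ + _] := metricg; apply: filterS => w sgw; rewrite trmx_inv sgw.
rewrite laplacian_hessian//; last by move=> i; have [_] := dP a; exact.
rewrite laplacian_coordinate_function// -/k -/dk.
have SV : invmx (S y) = (l2 y)^-1 *: g (P y).
  have Su : invmx (S y) *m S y = 1%:M.
    by rewrite mulVmx//; exact: nbhs_singleton (near_gram_unit metricG rankP).
  have Sg : S y *m ((l2 y)^-1 *: g (P y)) = 1%:M.
    rewrite (nbhs_singleton near_gramE) -scalemxAl -scalemxAr mulVmx//.
    by rewrite scalerA mulfV// scale1r.
  by rewrite -[RHS]mul1mx -Su -[RHS]mulmxA Sg mulmx1.
have lin (X Y : 'rV[R]_m) (c d : R) : c *: X + d *: Y = 0 ->
    c * (X *m D) 0 a + d * (Y *m D) 0 a = 0.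
  move=> XY; transitivity ((c *: (X *m D) + d *: (Y *m D)) 0 a).
    by rewrite [RHS]mxE [X in _ = X + _]mxE [X in _ = _ + X]mxE.
  by rewrite !scalemxAl -mulmxDl XY mul0mx mxE.
have := lin _ _ _ _ harmP.
rewrite (mean_curvature_hessian metricG dP rankP).
rewrite -mulmxA (nbhs_singleton (near_hprojK metricG rankP)).
have -> : (gradient G (fun z => ln (lam z)) y *m D) 0 a = (2 * l2 y)^-1 * L a.
  rewrite mxE /L mulr_sumr.
  under eq_bigr do rewrite mxE mulr_suml.
  rewrite exchange_big; apply: eq_bigr => l _ /=.
  under eq_bigr do rewrite partial_ln_dilation// mulrAC.
  rewrite -mulr_suml mulrCA; refine (f_equal2 *%R erefl (f_equal2 *%R _ erefl)).
  by rewrite mxE; apply: eq_bigr => k0 _; rewrite mulrC [in RHS]mxE.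
rewrite SV.
have -> : \sum_b \sum_c ((l2 y)^-1 *: g (P y)) b c *
     (\sum_p \sum_q A b p * A c q * hessian G (fun z => P z 0 a) y p q) =
  (2 - n%:R) / (2 * l2 y) * L a
  + l2 y * (\sum_c dk c a c
          - 2^-1 * \sum_d k a d * \sum_b \sum_c g (P y) b c * dk d b c).
  rewrite -(conformal_contraction _ (mulVmx ug) sk sg l20 sdk).
  apply: eq_bigr => b _; apply: eq_bigr => c _; rewrite mxE; congr (_ * _).
  by rewrite (hessian_gram metricG dP symP) !along_gram.
have alg (X c l La N : R) : l != 0 ->
    (N - 2) * ((2 * l)^-1 * La) + ((2 - N) / (2 * l) * La + l * c - X) = 0 ->
    X = l * c.
  move=> l0; rewrite (_ : _ + _ = l * c - X) => [/eqP|]; last by field.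
  by rewrite subr_eq0 => /eqP.
exact: alg.
Qed.

(** The expansion [laplacian_comp_expansion] is used twice: for [P], and for the
    identity of the target. *)
Lemma laplacian_comp_harmonic h : twice_differentiable h (P y) ->
  laplacian G (h \o P) y = l2 y * laplacian g h (P y).
Proof.
move=> dh.
rewrite (laplacian_comp_expansion metricG dP dh).
have did a : twice_differentiable (fun w : 'rV[R]_n => w 0 a) (P y).
  exact: twice_differentiable_coord.
have dhid : twice_differentiable h (id (P y)) by [].
have -> : laplacian g h (P y) = laplacian g (h \o (fun w => w)) (P y) by [].
rewrite (laplacian_comp_expansion metricg did dhid) jacobian_id.
rewrite trmx1 mul1mx mulmx1 -/k mulrDr.
refine (f_equal2 +%R _ _); rewrite mulr_sumr; apply: eq_bigr => a _.
  rewrite mulr_sumr; apply: eq_bigr => b _; rewrite mulrA.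
  refine (f_equal2 *%R _ erefl).
  have := nbhs_singleton near_gramE => /matrixP/(_ a b).
  by rewrite [in RHS]mxE.
by rewrite laplacian_component mulrCA.
Qed.

End conformal.

Section germs.
Context {R : realType}.

Lemma Ck_onW n k (U : set 'rV[R]_n) f : Ck_on k.+1 U f -> Ck_on k U f.
Proof.
elim: k f => [|k IH] f [cf df]; split=> // i; have [d1 d2] := df i.
by split=> //; exact: IH.
Qed.

Lemma C2_twice_differentiable n (U : set 'rV[R]_n) f y :
  open U -> U y -> Ck_on 2 U f -> twice_differentiable f y.
Proof.
move=> oU Uy fC2; split.
  apply: filterS (open_nbhs_nbhs (conj oU Uy)) => z Uz.
  exact: C1_differentiable oU Uz (Ck_onW fC2).
by move=> i; have [_ /(_ i)[_ dfi]] := fC2; exact: C1_differentiable dfi.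
Qed.

Lemma near_near (V : topologicalType) (y : V) (Q : V -> Prop) :
  (\forall z \near y, Q z) -> \forall z \near y, \forall w \near z, Q w.
Proof. exact: nbhs_interior. Qed.

Lemma laplacian_near n (G : 'rV[R]_n -> 'M[R]_n) f f' y :
  (\forall z \near y, f z = f' z) -> laplacian G f y = laplacian G f' y.
Proof.
move=> ff'.
have gradE : \forall z \near y, gradient G f z = gradient G f' z.
  apply: filterS (near_near ff') => z ffz; apply/rowP => k.
  rewrite /gradient mxE [RHS]mxE; apply: eq_bigr => l _.
  exact: (f_equal2 *%R erefl (partial_near l ffz)).
rewrite /laplacian /divergence; apply: eq_bigr => i _.
rewrite /nabla mxE [RHS]mxE; refine (f_equal2 +%R _ _); last first.
  by rewrite (nbhs_singleton gradE).
apply: eq_bigr => j _; refine (f_equal2 *%R erefl _).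
by apply: partial_near; apply: filterS gradE => z ->.
Qed.

End germs.

Section charts.
Context {R : realType} {n : nat} {M : @smooth_manifold R n}.
Implicit Types (a : @chart R n M) (x : M).

(** By continuity of the inverse of the chart. *)
Lemma chart_image_open a (W : set M) : open W ->
  open (a @` (chart_dom a `&` W)).
Proof.
move=> oW; rewrite openE => _ [x [ax Wx] <-].
have cod : chart_cod a (a x) by exists x.
have nW : nbhs (a x) (chart_inv a @^-1` W).
  apply: (chart_inv_continuous cod); rewrite chart_mapK//.
  exact: open_nbhs_nbhs.
have nC : nbhs (a x) (chart_cod a).
  by apply: open_nbhs_nbhs; split=> //; exact: chart_cod_open.
apply: filterS2 nW nC => z Wz [x' ax' x'z].
exists x' => //; split=> //; move: Wz; rewrite /preimage/= -x'z chart_mapK//.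
Qed.

Lemma chart_atP x : atlas (chart_at x) /\ chart_dom (chart_at x) x.
Proof. by rewrite /chart_at; case: cid2. Qed.

End charts.

Section metric_in_chart.
Context {R : realType} {n : nat} {M : @riemannian_manifold R n}.

Lemma metric_chart_germ (a : @chart R n M) x : atlas a -> chart_dom a x ->
  metric_germ (metric a) (a x).
Proof.
move=> aa ax.
have oC : open (chart_cod a) by exact: chart_cod_open.
have Cx : chart_cod a (a x) by exists x.
have nC : \forall z \near a x, chart_cod a z by exact: open_nbhs_nbhs.
split.
- by move=> i j; apply: (C1_differentiable oC Cx); exact: Defs.metric_smooth.
- by apply: filterS nC => z Cz; exact: (Defs.metric_sym aa Cz).
- by apply: filterS nC => z Cz; exact: (Defs.metric_pos aa Cz).
Qed.

End metric_in_chart.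

Section submersion_in_charts.
Context {R : realType} {m n : nat}.
Context {N : @riemannian_manifold R m} {M : @riemannian_manifold R n}.
Variables (pi : N -> M) (a : @chart R m N) (b : @chart R n M) (x : N).
Hypotheses (aa : atlas a) (ab : atlas b).
Hypotheses (ax : chart_dom a x) (bx : chart_dom b (pi x)).
Hypothesis pi_submersion : submersion pi.
Let P := in_charts pi a b.
Let U := a @` (chart_dom a `&` (pi @^-1` chart_dom b)).

Lemma in_charts_domain_open : open U.
Proof.
have [[cpi _] _] := pi_submersion.
apply: chart_image_open; move/continuousP: cpi; apply; exact: chart_dom_open.
Qed.

Lemma in_charts_domain_near : \forall z \near a x, exists2 x',
  chart_dom a x' /\ chart_dom b (pi x') & z = a x'.
Proof.
have : nbhs (a x) U.
  by apply: open_nbhs_nbhs; split; [exact: in_charts_domain_open|exists x].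
by apply: filterS => z [x' [? ?] <-]; exists x'.
Qed.

Lemma in_chartsE x' : chart_dom a x' -> P (a x') = b (pi x').
Proof. by move=> ax'; rewrite /P /in_charts/= chart_mapK. Qed.

Let Ux : U (a x). Proof. by exists x. Qed.

Lemma in_charts_C2 c : Ck_on 2 U (fun z => P z 0 c).
Proof. by have [[_ +] _] := pi_submersion; apply. Qed.

Lemma in_charts_twice_differentiable c :
  twice_differentiable (fun z => P z 0 c) (a x).
Proof.
exact: C2_twice_differentiable in_charts_domain_open Ux (in_charts_C2 c).
Qed.

Lemma in_charts_partialC c p q :
  partial p (partial q (fun z => P z 0 c)) (a x) =
  partial q (partial p (fun z => P z 0 c)) (a x).
Proof. exact: partialC in_charts_domain_open Ux (in_charts_C2 c). Qed.

Lemma in_charts_rank : \forall z \near a x, \rank ('J P z) = n.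
Proof.
apply: filterS in_charts_domain_near => _ [x' [ax' bx'] ->].
by have [_ +] := pi_submersion; apply.
Qed.

End submersion_in_charts.

(** Both Laplace-Beltrami operators are evaluated in the charts chosen by
    their definition, at [x] and at [pi x]; these are the charts [a] and [b] in
    which [pi] is expressed. *)
Lemma laplace_beltrami_comp {R : realType} {m n : nat}
    {N : @riemannian_manifold R m} {M : @riemannian_manifold R n}
    (pi : N -> M) (lambda : N -> R) (u : M -> R) (x : N) :
  harmonic_morphism pi lambda -> Ck_function 2 u ->
  laplace_beltrami (u \o pi) x = lambda x ^+ 2 * laplace_beltrami u (pi x).
Proof.
move=> [sub [lam_gt0 conf] harm] uC2.
rewrite /laplace_beltrami.
have [aa ax] := chart_atP x; set a := chart_at x in aa ax *.
have [ab bx] := chart_atP (pi x); set b := chart_at (pi x) in ab bx *.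
have near_dom := in_charts_domain_near ax bx sub.
rewrite (@laplacian_near _ _ _ _ ((u \o chart_inv b) \o in_charts pi a b)); last first.
  apply: filterS near_dom => _ [x' [ax' bx'] ->].
  by rewrite /in_charts/= !chart_mapK.
have P0 : in_charts pi a b (a x) = b (pi x) by exact: in_chartsE.
have metricg := metric_chart_germ ab bx.
have du : twice_differentiable (u \o chart_inv b) (b (pi x)).
  apply: C2_twice_differentiable (uC2 b ab); first exact: chart_cod_open.
  by exists (pi x).
rewrite -P0 in metricg du *.
have -> : lambda x ^+ 2 = lambda (chart_inv a (a x)) ^+ 2 by rewrite chart_mapK.
refine (@laplacian_comp_harmonic R m n (metric a) (in_charts pi a b) (metric b)
  (fun z => lambda (chart_inv a z)) (a x) (metric_chart_germ aa ax)
  (in_charts_twice_differentiable aa ab ax bx sub)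
  (in_charts_partialC aa ab ax bx sub) (in_charts_rank aa ab ax bx sub)
  metricg (fun z => lam_gt0 _) _ (harm a b aa ab x ax bx) _ du).
apply: filterS near_dom => _ [x' [ax' bx'] ->] X Y hX hY.
rewrite in_chartsE// chart_mapK//.
exact: conf.
Qed.

(** * Surjectivity of submersions from compact manifolds *)

Section local_minimum.
Context {R : realType}.

Lemma partial_local_min n (f : 'rV[R]_n -> R) (y : 'rV[R]_n) i :
  (\forall z \near y, differentiable f z) -> (\forall z \near y, f y <= f z) ->
  partial i f y = 0.
Proof.
move=> df fmin.
have /nbhs_ballP[r /= r0 rP] : nbhs y [set z | differentiable f z /\ f y <= f z].
  by apply: filterS2 df fmin.
pose phi t := f (y + t *: basis_vec i).
have inball (t : R) : t \in `]-r, r[ -> ball y r (y + t *: basis_vec i).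
  rewrite in_itv/= -ltr_norml => tr; rewrite -ball_normE/= opprD addNKr normrN.
  by apply: le_lt_trans tr; exact: norm_scale_basis_vec.
have line (t : R) : t \in `]-r, r[ ->
    is_derive t 1 phi (partial i f (y + t *: basis_vec i)).
  move=> /inball/rP[dft _]; apply: is_derive_line; exact: diff_derivable.
have z0 : (0 : R) \in `]-r, r[ by rewrite in_itv/= oppr_lt0 r0.
have rr : - r <= r by rewrite (@le_trans _ _ 0)// ?oppr_le0 ltW.
have d0 : is_derive (0 : R) 1 phi 0.
  apply: (derive1_at_min rr _ z0).
    by move=> t /line[].
  by move=> t /inball/rP[_]; rewrite /phi scale0r addr0.
have [_] := line 0 z0; have [_ ->] := d0.
by rewrite scale0r addr0 => <-.
Qed.

Definition sqdist {n} (c w : 'rV[R]_n) : R :=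
  \sum_j (w 0 j - c 0 j) * (w 0 j - c 0 j).

Lemma sqdist_differentiable n (c w : 'rV[R]_n) : differentiable (sqdist c) w.
Proof.
apply: differentiable_fsum => j.
have d : differentiable (fun z : 'rV[R]_n => z 0 j - c 0 j) w.
  by apply: differentiableB; [exact: differentiable_coord|exact: differentiable_cst].
exact: differentiableM.
Qed.

Lemma partial_sqdist n (c w : 'rV[R]_n) j :
  partial j (sqdist c) w = 2 * (w 0 j - c 0 j).
Proof.
have dc l : differentiable (fun z : 'rV[R]_n => z 0 l - c 0 l) w.
  by apply: differentiableB; [exact: differentiable_coord|exact: differentiable_cst].
have pc l : partial j (fun z : 'rV[R]_n => z 0 l - c 0 l) w = (j == l)%:R.
  have -> : partial j (fun z : 'rV[R]_n => z 0 l - c 0 l) w =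
      partial j (fun z => z 0 l) w - partial j (fun=> c 0 l) w.
    by apply: deriveB; apply: diff_derivable;
      [exact: differentiable_coord|exact: differentiable_cst].
  by rewrite partial_cst subr0 partial_coord.
rewrite /sqdist (partial_sum j
  (F := fun l z => (z 0 l - c 0 l) * (z 0 l - c 0 l))); last first.
  by move=> l; exact: differentiableM.
rewrite (bigD1 j)//= big1 => [|l /negbTE lj].
  by rewrite partialM// pc eqxx addr0 mul1r mulr1 mulr_natl.
by rewrite partialM// pc eq_sym lj mulr0 mul0r addr0.
Qed.

Lemma sqdist_bound n (c w : 'rV[R]_n) (r : R) : 0 <= r ->
  sqdist c w <= r ^+ 2 -> `|w - c| <= r.
Proof.
move=> r0 cw; apply: norm_le_coord => // j.
rewrite !mxE -(@ler_pXn2r _ 2)// ?nnegrE//.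
rewrite real_normK ?num_real// expr2; apply: le_trans cw.
rewrite /sqdist (bigD1 j)//= lerDl; apply: sumr_ge0 => l _.
by rewrite -expr2 sqr_ge0.
Qed.

(** At a critical point of the squared distance to [c] the vector [P y - c] is
    annihilated by the Jacobian, which is injective on the cotangent side. *)
Lemma submersion_local_min m n (P : 'rV[R]_m -> 'rV[R]_n) y c :
  (\forall z \near y, differentiable P z) -> \rank ('J P y) = n ->
  (\forall z \near y, sqdist c (P y) <= sqdist c (P z)) -> P y = c.
Proof.
move=> dP rP cmin.
have dPy := nbhs_singleton dP.
have crit i : partial i (sqdist c \o P) y = 0.
  apply: partial_local_min cmin.
  apply: filterS dP => z dPz; apply: differentiable_comp => //.
  exact: sqdist_differentiable.
have : 'J P y *m (P y - c)^T = 0.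
  apply/matrixP => i k; rewrite [RHS]mxE mxE; have := crit i.
  rewrite partial_comp//; last exact: sqdist_differentiable.
  under eq_bigr do rewrite partial_sqdist mulrCA.
  rewrite -mulr_sumr => /eqP; rewrite mulf_eq0 pnatr_eq0/= => /eqP E.
  by rewrite -[RHS]E; apply: eq_bigr => j _; rewrite !mxE (ord1 k).
move=> /(congr1 trmx); rewrite trmx_mul trmxK trmx0 => E.
have fJ : row_free ('J P y)^T by rewrite /row_free mxrank_tr rP.
apply/eqP; rewrite -subr_eq0; apply/eqP; apply: (row_free_inj fJ).
by rewrite E mul0mx.
Qed.

End local_minimum.

Section surjectivity.
Context {R : realType} {m n : nat}.
Context {N : @riemannian_manifold R m} {M : @riemannian_manifold R n}.
Variables (pi : N -> M).
Hypotheses (N_compact : compact [set: N]) (pi_submersion : submersion pi).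

Let cpi : continuous pi. Proof. by have [[]] := pi_submersion. Qed.

Lemma range_compact : compact (range pi).
Proof. by apply: continuous_compact => //; exact: continuous_subspaceT. Qed.

Lemma range_closed : closed (range pi).
Proof. apply: compact_closed range_compact; exact: manifold_hausdorff. Qed.

(** For [c] close to [w0 = b (pi x0)], the point of the range closest to [c],
    among those in a compact ball of the chart, lies in the interior of the ball;
    it is therefore a local minimum along [pi]. *)
Lemma range_open : open (range pi).
Proof.
rewrite openE => _ [x0 _ <-].
have [ab bx] := chart_atP (pi x0); set b := chart_at (pi x0) in ab bx *.
set w0 := b (pi x0).
have Cw0 : nbhs w0 (chart_cod b).
  by apply: open_nbhs_nbhs; split; [exact: chart_cod_open|exists (pi x0)].
have [rp rC] := (nbhs_closedballP _ _).1 Cw0.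
have r0 : 0 < rp%:num by [].
move: (rp%:num) r0 rC => r r0 rC.
set B := closed_ball w0 r in rC.
have BE w : B w <-> `|w0 - w| <= r by rewrite /B closed_ballE.
have Bcompact : compact B.
  apply: bounded_closed_compact; last exact: closed_ball_closed.
  exists (r + `|w0|); split; first exact: num_real.
  move=> e re w /BE w0w; apply: le_trans (ltW re).
  by rewrite -[w](subrK w0) (le_trans (ler_normD _ _))// lerD2r distrC.
pose C := chart_inv b @` B.
have Ccompact : compact C.
  apply: continuous_compact => //; apply: continuous_in_subspaceT => w.
  by rewrite inE => /rC; exact: chart_inv_continuous.
have Cdom y : C y -> chart_dom b y /\ B (b y).
  by move=> [w Bw <-]; have [y' by' yw] := rC w Bw; rewrite -yw chart_mapK// yw.
have Kcompact : compact (range pi `&` C).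
  apply: compact_closedI range_compact _.
  by apply: compact_closed Ccompact; exact: manifold_hausdorff.
have Kx0 : (range pi `&` C) (pi x0).
  split; first by exists x0.
  by exists w0; [apply/BE; rewrite subrr normr0 ltW|rewrite /w0 chart_mapK].
have hit c : sqdist c w0 <= (r / 4) ^+ 2 ->
    exists2 x, chart_dom b (pi x) & b (pi x) = c.
  move=> cw0.
  have [|_ /set_mem[[x1 _ <-] C1] ymin] :=
      @compact_EVT_min _ R (fun y => sqdist c (b y)) _ (ex_intro _ _ Kx0) Kcompact.
    apply: continuous_in_subspaceT => y /set_mem[_ /Cdom[by_ _]].
    apply: (@continuous_comp _ _ _ b (sqdist c)); first exact: chart_map_continuous.
    exact/differentiable_continuous/sqdist_differentiable.
  have [bx1 _] := Cdom _ C1.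
  exists x1 => //.
  have [aa ax] := chart_atP x1; set a := chart_at x1 in aa ax *.
  rewrite -(in_chartsE pi b ax).
  have r4 : 0 <= r / 4 by rewrite divr_ge0// ltW.
  have w1c : sqdist c (b (pi x1)) <= (r / 4) ^+ 2.
    apply: le_trans cw0; apply: ymin; exact: mem_set.
  (* two points within [r / 4] of [c] are at distance less than [r] *)
  have w1w0 : `|w0 - b (pi x1)| < r.
    rewrite -(subrKA c) (le_lt_trans (ler_normD _ _))//.
    rewrite (@le_lt_trans _ _ (r / 4 + r / 4))//; last by lra.
    rewrite lerD//; first exact: sqdist_bound.
    by rewrite distrC; exact: sqdist_bound.
  have dP : \forall z \near a x1, differentiable (in_charts pi a b) z.
    exact: near_differentiable_rV
      (in_charts_twice_differentiable aa ab ax bx1 pi_submersion).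
  apply: (submersion_local_min dP).
    exact: nbhs_singleton (in_charts_rank aa ab ax bx1 pi_submersion).
  have nearB : \forall z \near a x1, `|w0 - in_charts pi a b z| < r.
    have cP := differentiable_continuous (nbhs_singleton dP).
    apply: (cP [set w | `|w0 - w| < r]).
    rewrite in_chartsE//.
    have : nbhs (b (pi x1)) (ball w0 r).
      by apply: open_nbhs_nbhs; split; [exact: ball_open|rewrite -ball_normE].
    by rewrite -ball_normE.
  apply: filterS2 nearB (in_charts_domain_near ax bx1 pi_submersion).
  move=> z zB [x' [ax' bx'] zx']; move: zB; rewrite zx' !in_chartsE// => x'B.
  apply: ymin; apply: mem_set; split; first by exists x'.
  by exists (b (pi x')); [apply/BE; exact: ltW|rewrite chart_mapK].
have near_w0 : nbhs (pi x0) [set y | chart_dom b y /\ sqdist (b y) w0 <= (r / 4) ^+ 2].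
  apply: filterI; first by apply: open_nbhs_nbhs; split => //; exact: chart_dom_open.
  have r4 : 0 < (r / 4) ^+ 2 by rewrite exprn_gt0// divr_gt0.
  have cont : {for pi x0, continuous (fun y => sqdist w0 (b y))}.
    apply: (@continuous_comp _ _ _ b (sqdist w0)); first exact: chart_map_continuous.
    exact/differentiable_continuous/sqdist_differentiable.
  have n0 : nbhs (sqdist w0 (b (pi x0))) [set t : R | t < (r / 4) ^+ 2].
    apply: open_nbhs_nbhs; split; first exact: open_lt.
    by rewrite /sqdist/= big1// => j _; rewrite subrr mul0r.
  have nH : nbhs (pi x0) [set y | sqdist w0 (b y) < (r / 4) ^+ 2] := cont _ n0.
  apply: filterS nH => y /ltW; rewrite /= /sqdist.
  by under eq_bigr do rewrite -mulrNN !opprB.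
apply: filterS near_w0 => y [by_ /hit[x bpx bxy]].
exists x => //.
by rewrite -[LHS](chart_mapK bpx) bxy chart_mapK.
Qed.

(** The part of a component that lies in the range is open and closed in it. *)
Lemma submersion_surjective :
  (forall y : M, connected_component [set: M] y `&` range pi !=set0) ->
  forall y, exists x, pi x = y.
Proof.
move=> meets y.
have := @component_connected M [set: M] y
  (connected_component [set: M] y `&` range pi) (meets y).
move=> /(_ (ex_intro2 _ _ _ range_open erefl) (ex_intro2 _ _ _ range_closed erefl)).
move=> E; have := connected_component_refl (x := y) (A := setT) I.
by rewrite -E => -[_ [x _ <-]]; exists x.
Qed.

End surjectivity.

(** * The two nonlinear equations *)

Theorem proposition1p1 (R : realType) (m n : nat)
    (N : @riemannian_manifold R m) (M : @riemannian_manifold R n)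
    (N_compact : compact [set: N]) (M_compact : compact [set: M])
    (pi : N -> M) (lambda : N -> R)
    (pi_harmonic : harmonic_morphism pi lambda)
    (* automatic when M is connected and N is nonempty *)
    (pi_meets_components :
       forall y : M, connected_component [set: M] y `&` range pi !=set0)
    (mu : M -> R) (mu_gt0 : forall y, 0 < mu y)
    (mu_pi : forall x, mu (pi x) = lambda x ^+ 2)
    (p eps : R) (p_gt2 : 2 < p) (eps_gt0 : 0 < eps)
    (u : M -> R) (u_gt0 : forall y, 0 < u y) (u_C2 : Ck_function 2 u) :
  let v := u \o pi in
  (forall y : M, - eps ^+ 2 * laplace_beltrami u y + (mu y)^-1 * u y
                 = (mu y)^-1 * u y `^ (p - 1))
  <->
  (forall x : N, - eps ^+ 2 * laplace_beltrami v x + v x = v x `^ (p - 1)).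
Proof.
move=> v.
have [pi_submersion [lambda_gt0 _] _] := pi_harmonic.
have equations x :
  - eps ^+ 2 * laplace_beltrami u (pi x) + (mu (pi x))^-1 * u (pi x)
    = (mu (pi x))^-1 * u (pi x) `^ (p - 1)
  <-> - eps ^+ 2 * laplace_beltrami v x + v x = v x `^ (p - 1).
  have l0 : lambda x ^+ 2 != 0 by rewrite expf_neq0// gt_eqF.
  rewrite /v (laplace_beltrami_comp x pi_harmonic u_C2) mu_pi /=.
  move: (laplace_beltrami u _) (u _) (u _ `^ _) (lambda x ^+ 2) l0 => L U W l l0.
  have -> : - eps ^+ 2 * (l * L) + U = l * (- eps ^+ 2 * L + l^-1 * U).
    by rewrite mulrDr mulVKf// mulrCA.
  by split=> [->|lW]; rewrite ?mulVKf// -lW mulKf.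
split=> [Hu x|Hv y]; first by apply/equations; exact: Hu.
have [x <-] := submersion_surjective N_compact pi_submersion pi_meets_components y.
by apply/equations; exact: Hv.
Qed.
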